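(* There is a deterministic algorithm in the $\mathsf{CD}$ model that solves $\mathsf{Broadcast}$ on any $n$-vertex network in $O(nN^2\log N\log n)$ time using $O(\log^3 N\log n)$ energy.
   Context: Radio network: connected undirected graph with $n$ vertices; synchronized slots; each vertex transmits, listens or idles per slot, transmit/listen costing one unit of energy; energy = maximum per-vertex number of such slots. $\mathsf{CD}$: a listener receives the message if exactly one neighbor transmits, hears silence if none, and noise (distinguishable from silence) if at least two. Deterministic setting: vertices have distinct IDs in $\{1,\ldots,N\}$. $\mathsf{Broadcast}$: a source vertex holds a message that all vertices must learn. *)

(* Defs.v *)
From mathcomp Require Import all_boot.
Set Implicit Arguments. Unset Strict Implicit. Unset Printing Implicit Defensive.

Inductive action (P : Type) := Transmit of P | Listen | Idle.
Arguments Listen {P}. Arguments Idle {P}.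

Inductive feedback (P : Type) := NoFeedback | Silence | Receive of P | Noise.
Arguments NoFeedback {P}. Arguments Silence {P}. Arguments Noise {P}.

(* A deterministic distributed algorithm, identical code at every vertex.
   Local state and packet types are arbitrary; local computation is free.
   [init n N id msg]: initial state of the vertex with ID [id] in an
   [n]-vertex network with ID space {1..N}; [msg = Some m] exactly at the
   source, which holds broadcast message [m] (messages are naturals).
   [act]: action chosen in the current slot; [upd]: state update with the
   slot's feedback; [out]: the message the vertex currently claims to know;
   [time n N]: the number of slots the algorithm runs. *)
Record algorithm := Algorithm {
  St : Type;
  Pk : Type;
  init : nat -> nat -> nat -> option nat -> St;
  act : St -> action Pk;
  upd : St -> feedback Pk -> St;
  out : St -> option nat;
  time : nat -> nat -> nat
}.
Arguments St : clear implicits. Arguments Pk : clear implicits.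
Arguments init : clear implicits. Arguments act : clear implicits.
Arguments upd : clear implicits. Arguments out : clear implicits.
Arguments time : clear implicits.

Definition tx_packet (P : Type) (a : action P) : option P :=
  match a with Transmit p => Some p | _ => None end.

Definition is_active (P : Type) (a : action P) : bool :=
  match a with Idle => false | _ => true end.

Section Exec.
Variables (A : algorithm) (n : nat) (adj : rel 'I_n).

Definition feedback_of (c : 'I_n -> St A) (v : 'I_n) : feedback (Pk A) :=
  match act A (c v) with
  | Listen =>
      match pmap (fun u => if adj v u then tx_packet (act A (c u)) else None)
                 (enum 'I_n) with
      | [::] => Silence
      | [:: p] => Receive p
      | _ => Noise
      end
  | _ => NoFeedback
  end.

Definition step (c : 'I_n -> St A) : 'I_n -> St A :=
  fun v => upd A (c v) (feedback_of c v).

Definition config (N : nat) (id : 'I_n -> nat) (s : 'I_n) (m : nat) (t : nat)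
  : 'I_n -> St A :=
  iter t step (fun v => init A n N (id v) (if v == s then Some m else None)).

Definition energy (N : nat) (id : 'I_n -> nat) (s : 'I_n) (m : nat)
  (T : nat) (v : 'I_n) : nat :=
  count (fun t => is_active (act A (config N id s m t v))) (iota 0 T).
End Exec.

Definition valid_network (n N : nat) (adj : rel 'I_n) (id : 'I_n -> nat) : Prop :=
  [/\ symmetric adj, irreflexive adj, (forall u v : 'I_n, connect adj u v),
      injective id & (forall v, 1 <= id v <= N)].

Definition lg (x : nat) : nat := trunc_log 2 x.

(* Main.v *)
(* The vertices are kept partitioned into clusters, each a rooted tree in which
   a vertex knows its cluster label, its depth and the identifier of its parent.
   Since slots can be reserved for a given depth and a given parent or child
   identifier, a minimum over a cluster is collected at its root and sent back
   with O(log N) active slots per vertex; with collision detection, a vertex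
   finds the least key among its neighbours by binary search over key prefixes.
   Clusters are merged in two rounds.  First every cluster whose label is a local
   minimum hooks onto its least neighbour h; then every cluster with a smaller
   neighbour hooks onto the least one.  A cluster that survives both rounds is
   h(p) for some local minimum p and is not itself a local minimum, so there are
   at least twice as many clusters as survivors.  A hooking cluster is first
   re-rooted at the vertex that attaches it.  The new depths are then spread in
   frames indexed by cluster label, in increasing order: each cluster takes part
   only in its own frame and in that of its target, whose depths are final by
   then, so chains of hooks of any length cost O(1) energy.  After
   O(log n) repetitions a single tree remains; re-rooting it at the source
   delivers the message. *)

Require Import Defs.
From mathcomp Require Import all_boot zify.
Set Implicit Arguments. Unset Strict Implicit. Unset Printing Implicit Defensive.

(** * Synchronous processes *)

Section Processes.
Variable P : Type.

(** Resumptions: phases compose by [bind], and what remains of the process serves as the local state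
    in [proc_algorithm]. A finished process idles forever. *)
Inductive proc (A : Type) : Type :=
| Done of A
| Step of action P & (feedback P -> proc A).

Fixpoint bind (A B : Type) (c : proc A) (k : A -> proc B) : proc B :=
  match c with
  | Done x => k x
  | Step a c' => Step a (fun f => bind (c' f) k)
  end.

(** [loopd] counts indices down from [m - 1] to 0, for bits from the top and depths from the leaves;
    [loopu] counts up from [i], for depths from the root and labels in increasing order. *)
Fixpoint loopd (S : Type) (m : nat) (body : nat -> S -> proc S) (s : S) : proc S :=
  if m is m'.+1 then bind (body m' s) (loopd m' body) else Done s.

Fixpoint loopu (S : Type) (i m : nat) (body : nat -> S -> proc S) (s : S) : proc S :=
  if m is m'.+1 then bind (body i s) (loopu i.+1 m' body) else Done s.

Definition proc_act (A : Type) (c : proc A) : action P :=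
  if c is Step a _ then a else Idle.

Definition proc_upd (A : Type) (c : proc A) (f : feedback P) : proc A :=
  if c is Step _ k then k f else c.

Definition proc_algorithm (init : nat -> nat -> nat -> option nat -> proc (option nat))
    (time : nat -> nat -> nat) : algorithm :=
  Algorithm init (@proc_act (option nat)) (@proc_upd (option nat))
    (fun c => if c is Done x then x else None) time.

Variables (n : nat) (adj : rel 'I_n).

Definition fb (acts : 'I_n -> action P) (v : 'I_n) : feedback P :=
  match acts v with
  | Listen =>
      match pmap (fun u => if adj v u then tx_packet (acts u) else None) (enum 'I_n) with
      | [::] => Silence
      | [:: p] => Receive p
      | _ => Noise
      end
  | _ => NoFeedback
  end.

(* [runs T c out e]: run in lockstep, the processes [c v] all terminate after
   exactly [T] slots with results [out v], and [v] is active in at most [e v]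
   of these slots. *)
Fixpoint runs (A : Type) (T : nat) (c : 'I_n -> proc A) (out : 'I_n -> A) (e : 'I_n -> nat) : Prop :=
  match T with
  | 0 => forall v, c v = Done (out v)
  | T'.+1 => exists acts k e',
      [/\ forall v, c v = Step (acts v) (k v),
          forall v, is_active (acts v) + e' v <= e v
        & runs T' (fun v => k v (fb acts v)) out e']
  end.

(** Stands in for functional extensionality. The slack between [e] and [e'] is absorbed by the first
    slot, so the later slots keep their budget. *)
Lemma runs_weaken A T (c c' : 'I_n -> proc A) out out' e e' :
  c =1 c' -> out =1 out' -> (forall v, e v <= e' v) ->
  runs T c out e -> runs T c' out' e'.
Proof.
move=> Hc Ho He; case: T => [|T] /=.
  by move=> H v; rewrite -Hc -Ho.
case=> acts [k [e0 [H1 H2 H3]]]; exists acts, k, e0; split.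
- by move=> v; rewrite -Hc.
- by move=> v; apply: leq_trans (He v).
elim: T (fun v => k v (fb acts v)) e0 H3 {H1 H2} => [|T IH] d e0 /=.
  by move=> H v; rewrite -Ho.
by case=> a [k' [e1 [H1 H2 /IH H3]]]; exists a, k', e1.
Qed.

Lemma runs_out A T (c : 'I_n -> proc A) out out' e :
  out =1 out' -> runs T c out e -> runs T c out' e.
Proof. by move=> H; apply: runs_weaken. Qed.

Lemma runs_le A T (c : 'I_n -> proc A) out e e' :
  (forall v, e v <= e' v) -> runs T c out e -> runs T c out e'.
Proof. by move=> H; apply: runs_weaken. Qed.

Lemma runs_done A (out : 'I_n -> A) e : runs 0 (fun v => Done (out v)) out e.
Proof. by []. Qed.

(** The length [T1] is common to all vertices, so the second phases start in the same slot and stay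
    in lockstep. *)
Lemma runs_bind A B T1 T2 (c : 'I_n -> proc A) (k : 'I_n -> A -> proc B) a b e1 e2 :
  runs T1 c a e1 -> runs T2 (fun v => k v (a v)) b e2 ->
  runs (T1 + T2) (fun v => bind (c v) (k v)) b (fun v => e1 v + e2 v).
Proof.
elim: T1 c e1 => [|T1 IH] c e1 /=.
  move=> Hc; apply: runs_weaken => // v; last by rewrite leq_addl.
  by rewrite Hc.
case=> acts [k' [e' [H1 H2 H3]]] H4.
exists acts, (fun v f => bind (k' v f) (k v)), (fun v => e' v + e2 v); split.
- by move=> v; rewrite H1.
- by move=> v; rewrite addnA leq_add2r.
exact: IH.
Qed.

Lemma runs_map A B T (c : 'I_n -> proc A) (k : 'I_n -> A -> B) a e :
  runs T c a e ->
  runs T (fun v => bind (c v) (fun x => Done (k v x))) (fun v => k v (a v)) e.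
Proof.
move=> H; rewrite -[T]addn0.
apply: (@runs_le _ _ _ _ (fun v => e v + 0)) => [v|]; first by rewrite addn0.
exact: runs_bind H (runs_done _ _).
Qed.

Lemma runs_loopd S T (body : 'I_n -> nat -> S -> proc S) (I : nat -> ('I_n -> S) -> Prop) e m s :
  (forall i s, i < m -> I i.+1 s ->
     exists2 s', runs T (fun v => body v i (s v)) s' (e i) & I i s') ->
  I m s ->
  exists2 s', runs (m * T) (fun v => loopd m (body v) (s v)) s'
                (fun v => \sum_(i < m) e i v) & I 0 s'.
Proof.
elim: m s => [|m IH] s Hb Hs; first by exists s => //; exact: runs_done.
have [s1 R1 I1] := Hb m s (ltnSn m) Hs.
have [|s2 R2 I2] := IH s1 _ I1; first by move=> i t lt; apply: Hb; rewrite ltnS ltnW.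
exists s2 => //; rewrite mulSn.
apply: (@runs_le _ _ _ _ (fun v => e m v + \sum_(i < m) e i v)).
  by move=> v; rewrite big_ord_recr /= addnC.
exact: runs_bind R1 R2.
Qed.

Lemma runs_loopu_from S T (body : 'I_n -> nat -> S -> proc S) (I : nat -> ('I_n -> S) -> Prop) e j m s :
  (forall i s, i < j + m -> I i s ->
     exists2 s', runs T (fun v => body v i (s v)) s' (e i) & I i.+1 s') ->
  I j s ->
  exists2 s', runs (m * T) (fun v => loopu j m (body v) (s v)) s'
                (fun v => \sum_(j <= i < j + m) e i v) & I (j + m) s'.
Proof.
elim: m j s => [|m IH] j s Hb Hs.
  by exists s; [exact: runs_done | rewrite addn0].
have [s1 R1 I1] := Hb j s ltac:(by lia) Hs.
have [|s2 R2 I2] := IH j.+1 s1 _ I1.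
  by move=> i t lt; apply: Hb; rewrite addnS -addSn.
exists s2; last by rewrite addnS -addSn.
rewrite mulSn.
apply: (@runs_le _ _ _ _ (fun v => e j v + \sum_(j.+1 <= i < j.+1 + m) e i v)).
  by move=> v; rewrite [leqRHS]big_ltn ?addSnnS //; lia.
exact: runs_bind R1 R2.
Qed.

Lemma runs_loopu S T (body : 'I_n -> nat -> S -> proc S) (I : nat -> ('I_n -> S) -> Prop) e m s :
  (forall i s, i < m -> I i s ->
     exists2 s', runs T (fun v => body v i (s v)) s' (e i) & I i.+1 s') ->
  I 0 s ->
  exists2 s', runs (m * T) (fun v => loopu 0 m (body v) (s v)) s'
                (fun v => \sum_(i < m) e i v) & I m s'.
Proof.
move=> Hb Hs; have [s' R I'] := runs_loopu_from (j := 0) Hb Hs.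
by exists s' => //; apply: runs_le R => v; rewrite big_mkord.
Qed.

(** The induction runs over all [d =1 c], because [step] reproduces the next configuration of [runs]
    only pointwise. *)
Lemma runs_algorithm init time T (c d : 'I_n -> proc (option nat)) out e :
  let A := proc_algorithm init time in
  runs T c out e -> d =1 c ->
  (forall v, iter T (@step A n adj) d v = Done (out v)) /\
  (forall v, count (fun t => is_active (act A (iter t (@step A n adj) d v))) (iota 0 T) <= e v).
Proof.
move=> A; elim: T c d e => [|T IH] c d e /=.
  by move=> Hc Hd; split=> // v; rewrite Hd.
case=> acts [k [e' [H1 H2 H3]]] Hd.
have Ha u : proc_act (d u) = acts u by rewrite Hd H1.
have Hs : @step A n adj d =1 (fun v => k v (fb acts v)).
  move=> v; rewrite /step /= Hd H1 /=; congr (k v _).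
  rewrite /feedback_of /fb /= Ha; case: (acts v) => //.
  by under eq_pmap => u do rewrite Ha.
have [IH1 IH2] := IH _ _ _ H3 Hs; split=> v.
  by rewrite -[RHS]IH1 -[in RHS]iterSr.
apply: leq_trans (H2 v); rewrite Ha leq_add2l.
apply: leq_trans (IH2 v); rewrite -[1]/(1 + 0) iotaDl count_map.
by apply: sub_count => t; rewrite /= -[in X in _ -> X]iterSr.
Qed.

End Processes.

(** Source of the energy bounds that do not depend on the number of frames: a vertex takes part only
    in the frames matching its depth or label. *)
Lemma sum_delta_le1 (m x : nat) : \sum_(i < m) (x == i) <= 1.
Proof.
apply: leq_trans (_ : #|[pred i : 'I_m | x == i]| <= 1).
  by rewrite -sum1_card [leqRHS]big_mkcond leq_sum // => i _; rewrite inE; case: eqP.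
apply/card_le1P => i; rewrite inE => /eqP Hi j; rewrite !inE Hi.
by apply/eqP/eqP => [/val_inj|->].
Qed.

(** * Multiplexed channels and minimum search *)

Section Channels.
Variable P : eqType.

(** Transmitting takes precedence over listening on the same channel; this is why the feedback
    lemmas below assume that the listener does not send on its own channel. *)
Definition chan_act (q : nat) (tx : option (nat * P)) (ls : option nat) : action P :=
  match tx with
  | Some (q', p) => if q' == q then Transmit p else if ls == Some q then Listen else Idle
  | None => if ls == Some q then Listen else Idle
  end.

(** Time-division multiplexing with one slot per channel number. A vertex sends on at most one
    channel and listens on at most one, so two active slots suffice however many channels there
    are. *)
Fixpoint chan (qs : seq nat) (tx : option (nat * P)) (ls : option nat) (acc : feedback P)
    : proc P (feedback P) :=
  if qs is q :: qs' then
    Step (chan_act q tx ls) (fun f => chan qs' tx ls (if ls == Some q then f else acc))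
  else Done P acc.

Definition heard (f : feedback P) : bool :=
  match f with Receive _ | Noise => true | _ => false end.

Definition received (f : feedback P) : option P :=
  if f is Receive p then Some p else None.

Variables (n : nat) (adj : rel 'I_n).

Definition chan_fb (tx : 'I_n -> option (nat * P)) (ls : 'I_n -> option nat) (v : 'I_n) : feedback P :=
  if ls v is Some q then fb adj (fun u => chan_act q (tx u) (ls u)) v else NoFeedback.

Lemma chan_act_count q tx ls :
  is_active (chan_act q tx ls) <= (omap fst tx == Some q) + (ls == Some q).
Proof.
rewrite /chan_act; case: tx => [[q' p]|] /=; last by case: (ls == _).
by rewrite -[Some q' == _]/(q' == q); case: (q' == q); case: (ls == _).
Qed.

Lemma count_Some_le1 (x : option nat) qs : uniq qs -> count (fun q => x == Some q) qs <= isSome x.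
Proof.
case: x => [x|] U; last by rewrite (@eq_count _ _ pred0) ?count_pred0.
by rewrite (@eq_count _ _ (pred1 x)) => [|q /=]; [rewrite count_uniq_mem ?leq_b1|rewrite eq_sym].
Qed.

Lemma runs_chan_seq qs tx ls acc :
  uniq qs ->
  runs adj (size qs) (fun v => chan qs (tx v) (ls v) (acc v))
    (fun v => if ls v is Some q then if q \in qs then chan_fb tx ls v else acc v else acc v)
    (fun v => count (fun q => omap fst (tx v) == Some q) qs + count (fun q => ls v == Some q) qs).
Proof.
elim: qs acc => [|q qs IH] acc; first by move=> _ v /=; case: (ls v).
case/andP => nq U /=.
exists (fun v => chan_act q (tx v) (ls v)).
exists (fun v f => chan qs (tx v) (ls v) (if ls v == Some q then f else acc v)).
exists (fun v => count (fun q => omap fst (tx v) == Some q) qs + count (fun q => ls v == Some q) qs).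
split=> [//|v|].
  by rewrite addnACA leq_add2r chan_act_count.
apply: runs_out (IH _ U) => v.
rewrite /chan_fb; case E: (ls v) => [r|] //; rewrite inE.
have -> : (Some r == Some q) = (r == q) by [].
by case: eqP => // ->; rewrite (negbTE nq).
Qed.

Lemma runs_chan m tx ls :
  (forall v q, ls v = Some q -> q < m) ->
  runs adj m (fun v => chan (iota 0 m) (tx v) (ls v) NoFeedback) (chan_fb tx ls)
    (fun v => isSome (tx v) + isSome (ls v)).
Proof.
move=> Hm; rewrite -[X in runs _ X](size_iota 0 m).
apply: runs_weaken (runs_chan_seq _ _ _ (iota_uniq 0 m)) => // v.
  case E: (ls v) => [q|]; last by rewrite /chan_fb E.
  by rewrite mem_iota (Hm _ _ E).
by rewrite leq_add ?count_Some_le1 ?iota_uniq // (leq_trans (count_Some_le1 _ (iota_uniq 0 m))) //; case: (tx v).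
Qed.

Section Feedback.
Variables (tx : 'I_n -> option (nat * P)) (ls : 'I_n -> option nat) (v : 'I_n) (q : nat).
Hypothesis Hls : ls v = Some q.
Hypothesis Htx : omap fst (tx v) != Some q.

Let on_chan u := if adj v u then tx_packet (chan_act q (tx u) (ls u)) else None.

Lemma on_chanE u p : on_chan u = Some p <-> adj v u /\ tx u = Some (q, p).
Proof.
rewrite /on_chan /chan_act; split.
  case: (adj v u) => //; case: (tx u) => [[q' p']|]; last by case: ifP.
  by case: eqP => [->|_] /=; [case=> -> | case: ifP].
by case=> -> ->; rewrite eqxx.
Qed.

Lemma chan_fbE :
  chan_fb tx ls v = match pmap on_chan (enum 'I_n) with
                    | [::] => Silence | [:: p] => Receive p | _ => Noise end.
Proof.
rewrite /chan_fb Hls /fb.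
suff -> : chan_act q (tx v) (ls v) = Listen by [].
rewrite /chan_act Hls eqxx; case: (tx v) Htx => [[q' p']|] //= ne.
by rewrite -[q' == q]/(Some q' == Some q) (negbTE ne).
Qed.

Lemma chan_heard : reflect (exists u p, adj v u /\ tx u = Some (q, p)) (heard (chan_fb tx ls v)).
Proof.
rewrite chan_fbE.
have -> : heard match pmap on_chan (enum 'I_n) with
                | [::] => Silence | [:: p] => Receive p | _ => Noise end
        = has (fun u => isSome (on_chan u)) (enum 'I_n).
  rewrite has_count -size_pmap.
  by case: (pmap _ _) => [|p [|p' s]].
apply: (iffP hasP) => [[u _]|[u [p]]].
  by case E: (on_chan u) => [p|] // _; exists u, p; apply/on_chanE.
by move/on_chanE => E; exists u; rewrite ?mem_enum ?E.
Qed.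

Lemma pmap_single (T : eqType) (g : T -> option P) u p s :
  uniq s -> u \in s -> g u = Some p -> (forall x, x != u -> g x = None) -> pmap g s = [:: p].
Proof.
move=> U Hu Gu Gn; elim: s U Hu => //= x s IH /andP [nx U].
rewrite inE; case: (eqVneq u x) => [ux _|ne /= Hu].
  rewrite -ux Gu /=; congr (_ :: _).
  move: nx; rewrite -ux; elim: s {IH U} => //= y s IH; rewrite inE negb_or eq_sym => /andP [ne ns].
  by rewrite Gn //= IH.
by rewrite Gn 1?eq_sym //= IH.
Qed.

Lemma chan_received u p :
  adj v u -> tx u = Some (q, p) ->
  (forall x p', adj v x -> tx x = Some (q, p') -> x = u) ->
  received (chan_fb tx ls v) = Some p.
Proof.
move=> Ha Hu Un; rewrite chan_fbE (@pmap_single _ on_chan u p) ?enum_uniq ?mem_enum //.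
  exact/on_chanE.
move=> x ne; case E: (on_chan x) => [p'|] //.
by case/on_chanE: E => a b; rewrite (Un x p') ?eqxx in ne.
Qed.

Lemma chan_received_inv p :
  received (chan_fb tx ls v) = Some p -> exists2 u, adj v u & tx u = Some (q, p).
Proof.
rewrite chan_fbE => H.
have : p \in pmap on_chan (enum 'I_n).
  by case: (pmap _ _) H => [|p' [|]] //= [->]; rewrite inE.
by rewrite mem_pmap => /mapP [u _] /esym /on_chanE [a b]; exists u.
Qed.

End Feedback.

End Channels.

Definition pkt : Type := nat * nat * option nat.
Definition pkt0 : pkt := (0, 0, None).

(* A vertex with [gk = Some (g, k)] offers the [w]-bit key [k] in group [g]; one
   with [gl = Some g] looks for the least key offered in group [g] within its
   closed neighbourhood, bit by bit from the top: after level [i] it knows the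
   prefix [c] of that key above bit [i].  Absence of keys reads as [2 ^ w - 1]. *)
Definition trie (G w : nat) (gk : option (nat * nat)) (gl : option nat) : proc pkt nat :=
  loopd w (fun i c =>
    let t := omap (fun x => x.1 * 2 ^ w + x.2 %/ 2 ^ i) gk in
    let l := omap (fun g => g * 2 ^ w + c.*2) gl in
    bind (chan (iota 0 (G * 2 ^ w)) (omap (pair^~ pkt0) t) (if t == l then None else l) NoFeedback)
      (fun f => Done _ (if (t == l) || heard f then c.*2 else c.*2.+1))) 0.

Section Trie.
Variables (n : nat) (adj : rel 'I_n) (G w : nat).
Variables (gk : 'I_n -> option (nat * nat)) (gl : 'I_n -> option nat).

Definition offers v g k := exists u, [/\ (u == v) || adj v u & gk u = Some (g, k)].

(** The listener tests the smaller candidate prefix [c.*2]. Noise is as good an answer as reception,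
    since only the presence of an offer matters. All offered prefixes are at least [c] at the level
    above, so a negative answer leaves [c.*2.+1], which also keeps the all-ones value when nothing
    is offered. *)
Lemma runs_trie :
  (forall u g k, gk u = Some (g, k) -> k < 2 ^ w) ->
  (forall v g, gl v = Some g -> g < G) ->
  exists2 r, runs adj (w * (G * 2 ^ w)) (fun v => trie G w (gk v) (gl v)) r
               (fun v => w * (isSome (gk v) + isSome (gl v)))
    & forall v g, gl v = Some g ->
        [/\ r v < 2 ^ w, (forall k, offers v g k -> r v <= k)
          & r v = (2 ^ w).-1 \/ offers v g (r v)].
Proof.
move=> Hk Hg.
pose I i (c : 'I_n -> nat) := i <= w /\ forall v g, gl v = Some g ->
  [/\ c v < 2 ^ (w - i), (forall k, offers v g k -> c v <= k %/ 2 ^ i)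
    & c v = (2 ^ (w - i)).-1 \/ exists2 k, offers v g k & c v = k %/ 2 ^ i].
have [||r Hr [_ Ir]] := @runs_loopd _ _ adj _ (G * 2 ^ w)
  (fun v i c => let t := omap (fun x => x.1 * 2 ^ w + x.2 %/ 2 ^ i) (gk v) in
    let l := omap (fun g => g * 2 ^ w + c.*2) (gl v) in
    bind (chan (iota 0 (G * 2 ^ w)) (omap (pair^~ pkt0) t) (if t == l then None else l) NoFeedback)
      (fun f => Done _ (if (t == l) || heard f then c.*2 else c.*2.+1))) I
   (fun i v => isSome (gk v) + isSome (gl v)) w (fun _ => 0).
- move=> i c lti [_ Ic].
  pose t v := omap (fun x => x.1 * 2 ^ w + x.2 %/ 2 ^ i) (gk v).
  pose l v := omap (fun g => g * 2 ^ w + (c v).*2) (gl v).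
  pose tx v := omap (pair^~ pkt0) (t v).
  pose ls v := if t v == l v then None else l v.
  pose bit v := (t v == l v) || heard (chan_fb adj tx ls v).
  have e2 : 2 ^ (w - i) = 2 * 2 ^ (w - i.+1) by rewrite -expnS; congr expn; lia.
  have e3 : 2 ^ (w - i) <= 2 ^ w by rewrite leq_exp2l //; lia.
  have e4 : 0 < 2 ^ (w - i.+1) by rewrite expn_gt0.
  have lv v g : gl v = Some g -> l v = Some (g * 2 ^ w + (c v).*2) by rewrite /l => ->.
  exists (fun v => if bit v then (c v).*2 else (c v).*2.+1).
    apply: (@runs_map _ _ adj _ _ _ (fun v => chan (iota 0 (G * 2 ^ w)) (tx v) (ls v) NoFeedback)
      (fun v f => if (t v == l v) || heard f then (c v).*2 else (c v).*2.+1)).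
    apply: runs_le (@runs_chan _ _ adj _ tx ls _) => [v|v q].
      rewrite /tx /ls /t /l; case: (gk v) => [x|]; case: (gl v) => [g|] //=; by case: ifP.
    rewrite /ls; case: ifP => // _; rewrite /l.
    case E: (gl v) => [g|] //= [<-].
    have := Hg _ _ E; have [h _ _] := Ic _ _ E.
    move=> ltg; have : g.+1 * 2 ^ w <= G * 2 ^ w by rewrite leq_mul2r ltg orbT.
    by rewrite mulSn; lia.
  split=> [|v g Ev]; first by lia.
  have [c1 c2 c3] := Ic _ _ Ev.
  (* Prefixes are below [2 ^ w], so a channel number determines both its group and its prefix. *)
  have chE x k : x < 2 ^ (w - i) -> k < 2 ^ w -> forall g', g' * 2 ^ w + k %/ 2 ^ i = g * 2 ^ w + x ->
      g' = g /\ k %/ 2 ^ i = x.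
    move=> ltx ltk g' E.
    have lk : k %/ 2 ^ i < 2 ^ w by apply: leq_ltn_trans (leq_div _ _) ltk.
    have lx : x < 2 ^ w := leq_trans ltx e3.
    have : (g' * 2 ^ w + k %/ 2 ^ i) %/ 2 ^ w = (g * 2 ^ w + x) %/ 2 ^ w by rewrite E.
    rewrite !divnMDl ?expn_gt0 // (divn_small lk) (divn_small lx) !addn0.
    by move=> Eg; split=> //; move: E; rewrite Eg => /addnI.
  have bitP : bit v <-> exists2 k, offers v g k & k %/ 2 ^ i = (c v).*2.
    rewrite /bit; split.
      case/orP=> [/eqP|].
        rewrite (lv _ _ Ev) /t; case E: (gk v) => [[g' k]|] //= [] H.
        have [||Eg Ek] := chE _ _ _ _ _ H; [by lia | exact: Hk E |].
        by exists k => //; exists v; rewrite eqxx E Eg.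
      case Etl: (t v == l v); first by rewrite /chan_fb /ls Etl.
      have Els : ls v = Some (g * 2 ^ w + (c v).*2) by rewrite /ls Etl (lv _ _ Ev).
      case/(chan_heard adj Els); first by rewrite -(lv _ _ Ev) /tx; case: (t v) Etl => [a|] /= ->.
      move=> u [p [au]]; rewrite /tx /t; case E: (gk u) => [[g' k]|] //= [] H _.
      have [||Eg Ek] := chE _ _ _ _ _ H; [by lia | exact: Hk E |].
      by exists k => //; exists u; rewrite au orbT E Eg.
    case=> k [u [Hu Eu]] Ek; case Etl: (t v == l v) => //=.
    have Els : ls v = Some (g * 2 ^ w + (c v).*2) by rewrite /ls Etl (lv _ _ Ev).
    apply/(chan_heard adj Els); first by rewrite -(lv _ _ Ev) /tx; case: (t v) Etl => [a|] /= ->.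
    exists u, pkt0; rewrite /tx /t Eu /= Ek; split=> //.
    case/orP: Hu => // /eqP Euv; move: Etl; rewrite (lv _ _ Ev) /t -Euv Eu /= Ek.
    by rewrite Euv eqxx.
  have half k : k %/ 2 ^ i.+1 = k %/ 2 ^ i %/ 2 by rewrite expnSr divnMA.
  case: ifP => Hb.
    have /bitP [k Ok Ek] := Hb; split; first by lia.
      by move=> k' /c2; rewrite half; lia.
    by right; exists k; rewrite ?Ek.
  have nb k : offers v g k -> k %/ 2 ^ i <> (c v).*2.
    move=> Ok Ek; suff : bit v by rewrite Hb.
    by apply/bitP; exists k.
  split; first by lia.
    by move=> k Ok; have := c2 _ Ok; have := nb _ Ok; rewrite half; lia.
  case: c3 => [c3|[k Ok Ek]]; first by left; lia.
  by right; exists k => //; have := nb _ Ok; move: Ek; rewrite half; lia.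
- split=> // v g Ev; rewrite subnn; split=> //; by left.
exists r.
  by apply: runs_le Hr => v; rewrite sum_nat_const card_ord.
move=> v g Ev; have := Ir _ _ Ev; rewrite subn0 expn0.
case=> h1 h2 h3; split=> // [k Ok|].
  by have := h2 _ Ok; rewrite divn1.
case: h3 => [->|[k Ok ->]]; [by left | by right; rewrite divn1].
Qed.

End Trie.

(** * Casts along cluster trees *)

Section CastPrograms.
Variables n N : nat.

(** Senders use the channel of their own identifier, so distinct clusters and distinct parents never
    collide. The map [h] is applied by the sender, and a vertex that already has a value keeps
    it. *)
Definition down (idv dep par : nat) (act : bool) (h : pkt -> pkt) (x : option pkt)
    : proc pkt (option pkt) :=
  loopu 0 n (fun i y =>
    bind (chan (iota 0 N.+1)
            (if act && (dep == i) then omap (fun d => (idv, h d)) y else None)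
            (if act && (dep == i.+1) && ~~ isSome y then Some par else None) NoFeedback)
      (fun f => Done _ (if act && (dep == i.+1) && ~~ isSome y then received f else y))) x.

(** Children send on the channel of their parent, so siblings could collide; the cast is meant for
    one source per cluster. *)
Definition climb (idv dep par : nat) (act : bool) (h : pkt -> pkt) (x : option pkt)
    : proc pkt (option pkt) :=
  loopd n (fun i y =>
    bind (chan (iota 0 N.+1)
            (if act && (dep == i.+1) then omap (fun d => (par, h d)) y else None)
            (if act && (dep == i) && ~~ isSome y then Some idv else None) NoFeedback)
      (fun f => Done _ (if act && (dep == i) && ~~ isSome y then received f else y))) x.

(** Here all siblings do speak at once, and the bitwise search of [trie], with the parent identifier
    as group, resolves the collisions. *)
Definition gather (w idv dep par key : nat) : proc pkt nat :=
  loopd n (fun i y =>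
    bind (trie N.+1 w (if dep == i.+1 then Some (par, y) else None)
            (if dep == i then Some idv else None))
      (fun r => Done _ (if dep == i then minn y r else y))) key.

Definition cluster_min (w idv dep par key : nat) : proc pkt nat :=
  bind (gather w idv dep par key) (fun y =>
  bind (down idv dep par true id (if dep == 0 then Some (y, 0, None) else None)) (fun z =>
  Done _ (if z is Some p then p.1.1 else 0))).

(** The packet carries new depth, new parent and message: each hop adds one to the depth and names
    the sender as parent of the receiver. *)
Definition reroot_hop (idv : nat) (p : pkt) : pkt := (p.1.1.+1, idv, p.2).

(** The climb reverses the tree path from the selected vertex to the old root; the downward cast
    then reaches the vertices off this path, which keep their parents. *)
Definition reroot (idv dep par : nat) (act sel : bool) (msg : option nat)
    : proc pkt (option pkt) :=
  bind (climb idv dep par act (reroot_hop idv) (if sel then Some (0, 0, msg) else None))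
    (down idv dep par act (reroot_hop idv)).

End CastPrograms.

Lemma sum_delta_succ_le1 (m x : nat) : \sum_(i < m) (x == i.+1) <= 1.
Proof.
case: x => [|x]; first by rewrite big1.
by under eq_bigr => i _ do rewrite eqSS; apply: sum_delta_le1.
Qed.

Section Casts.
Variables (n N : nat) (adj : rel 'I_n) (id : 'I_n -> nat).
Hypothesis adj_sym : symmetric adj.
Hypothesis id_inj : injective id.
Hypothesis id_le : forall v, id v <= N.

Definition parent (cid dep par : 'I_n -> nat) (v u : 'I_n) : Prop :=
  [/\ adj v u, id u = par v, cid u = cid v & (dep u).+1 = dep v].

(** Depths drop along parent pointers, which excludes cycles; uniqueness of the root makes each
    label stand for one tree. *)
Definition wf_clusters (cid dep par : 'I_n -> nat) : Prop :=
  (forall v, 0 < dep v -> exists u, parent cid dep par v u) /\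
  (forall u v, dep u = 0 -> dep v = 0 -> cid u = cid v -> u = v).

Variables cid dep par : 'I_n -> nat.
Hypothesis wf : wf_clusters cid dep par.

Lemma parent_ex v : 0 < dep v -> exists u, parent cid dep par v u.
Proof. by case: wf => H _; apply: H. Qed.

Lemma parent_uniq v u u' : id u = par v -> parent cid dep par v u' -> u = u'.
Proof. by move=> E [_ E' _ _]; apply: id_inj; rewrite E. Qed.

(** The ancestors of [v] realise every depth from 0 to [dep v], and only [n] vertices are available.
    Hence [n] frames cover all depths. *)
Lemma dep_lt v : dep v < n.
Proof.
have H k u d : dep u = k -> d <= k -> exists u', dep u' = d.
  elim: k u => [|k IH] u Eu; first by rewrite leqn0 => /eqP ->; exists u.
  rewrite leq_eqVlt => /orP [/eqP ->|]; first by exists u.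
  have [|u' [_ _ _ E]] := @parent_ex u; first by rewrite Eu.
  by move=> lt; apply: (IH u'); lia.
have : {subset iota 0 (dep v).+1 <= map dep (enum 'I_n)}.
  move=> d; rewrite mem_iota add0n ltnS => /(H _ _ _ (erefl _)) [u <-].
  by apply: map_f; rewrite mem_enum.
move/(uniq_leq_size (iota_uniq _ _)).
by rewrite size_iota size_map size_enum_ord.
Qed.

Lemma root_ex v : exists2 r, dep r = 0 & cid r = cid v.
Proof.
move: {2}(dep v) (erefl (dep v)) => k; elim: k v => [|k IH] u Eu; first by exists u.
have [|u' [_ _ Ec E]] := @parent_ex u; first by rewrite Eu.
by have [|r Hr Hc] := IH u'; [lia | exists r; rewrite // Hc].
Qed.

Lemma par_le v : 0 < dep v -> par v <= N.
Proof. by case/parent_ex => u [_ <-]. Qed.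

(** * Casts from the root towards the leaves *)

Section Down.
Variables (act : 'I_n -> bool) (h : 'I_n -> pkt -> pkt) (x : 'I_n -> option pkt).
Hypothesis Hact : forall u v, cid u = cid v -> act u = act v.

Let down_ok (y : 'I_n -> option pkt) v :=
  act v -> x v = None ->
    (dep v = 0 -> y v = None) /\
    (forall u, parent cid dep par v u -> y v = omap (h u) (y u)).

(** The result is given by its recursion along parent pointers, so users conclude by induction on
    depth. The factor 2 counts one listening and one sending slot. *)
Lemma runs_down :
  exists2 z, runs adj (n * N.+1) (fun v => down n N (id v) (dep v) (par v) (act v) (h v) (x v)) z
               (fun v => 2 * act v)
    & [/\ forall v, act v = false -> z v = x v,
          forall v d, x v = Some d -> z v = Some d,
          forall v, act v -> x v = None -> dep v = 0 -> z v = None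
        & forall v u, act v -> x v = None -> parent cid dep par v u -> z v = omap (h u) (z u)].
Proof.
pose I i (y : 'I_n -> option pkt) :=
  [/\ forall v, act v = false \/ i < dep v -> y v = x v,
      forall v d, x v = Some d -> y v = Some d
    & forall v, dep v <= i -> down_ok y v].
have [||z Hz [I1 I2 I3]] := @runs_loopu _ _ adj _ N.+1
  (fun v i y => bind (chan (iota 0 N.+1)
            (if act v && (dep v == i) then omap (fun d => (id v, h v d)) y else None)
            (if act v && (dep v == i.+1) && ~~ isSome y then Some (par v) else None) NoFeedback)
      (fun f => Done _ (if act v && (dep v == i.+1) && ~~ isSome y then received f else y))) I
  (fun i v => act v * ((dep v == i) + (dep v == i.+1))) n x.
- move=> i y lti [I1 I2 I3].
  pose tx v := if act v && (dep v == i) then omap (fun d => (id v, h v d)) (y v) else None.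
  pose ls v := if act v && (dep v == i.+1) && ~~ isSome (y v) then Some (par v) else None.
  pose y' v := if act v && (dep v == i.+1) && ~~ isSome (y v) then received (chan_fb adj tx ls v) else y v.
  have y'E v : act v = false \/ dep v != i.+1 -> y' v = y v.
    by rewrite /y'; case=> [->|/negbTE ->] //=; rewrite andbF.
  exists y'.
    apply: (@runs_map _ _ adj _ _ _ (fun v => chan (iota 0 N.+1) (tx v) (ls v) NoFeedback)
      (fun v f => if act v && (dep v == i.+1) && ~~ isSome (y v) then received f else y v)).
    apply: runs_le (@runs_chan _ _ adj _ tx ls _) => [v|v q].
      rewrite /tx /ls; case: (act v) => //=; rewrite mul1n leq_add //.
        by case: (dep v == i) => //; case: (y v).
      by case: (dep v == i.+1) => //=; case: ifP.
    rewrite /ls; case: ifP => // /andP [/andP [_ /eqP Ed] _] [<-].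
    by rewrite ltnS par_le // Ed.
  split.
  + move=> v H; rewrite y'E; first by apply: I1; case: H => H; [left|right; lia].
    by case: H => H; [left|right; lia].
  + move=> v d E; rewrite /y' (I2 _ _ E) /= andbF //.
  + move=> v le Av Xv; split=> [E|u Pu].
      by have [|H _] := I3 v _ Av Xv; [lia | rewrite y'E ?H //; right; lia].
    have [a1 a2 a3 a4] := Pu.
    have Eu : y' u = y u by rewrite y'E //; right; lia.
    rewrite Eu; case: (ltngtP (dep v) i.+1) => Hd; [|by lia|].
      rewrite y'E; last by right; lia.
      by have [|_] := I3 v _ Av Xv; [lia | apply].
    have Yv : y v = None by rewrite I1 //; right; lia.
    have Lv : ls v = Some (par v) by rewrite /ls Av Hd eqxx Yv.
    have Tv : omap fst (tx v) != Some (par v).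
      by rewrite /tx Hd (gtn_eqF (ltnSn i)) andbF.
    rewrite /y' Av Hd eqxx Yv /=.
    have Tu : tx u = omap (fun d => (par v, h u d)) (y u).
      by rewrite /tx (Hact a3) Av a2; have -> : dep u == i by lia.
    case Yu: (y u) => [d|] /=.
      apply: (chan_received Lv Tv a1); first by rewrite Tu Yu.
      move=> u' p _; rewrite /tx; case: ifP => // _; case: (y u') => //= d' [E _].
      by apply: id_inj; rewrite E.
    case E: (received _) => [p|] //.
    have [u' _] := chan_received_inv Lv Tv E.
    rewrite /tx; case: ifP => // _; case Y': (y u') => [d'|] //= [E' _].
    by move: Y'; rewrite (parent_uniq E' Pu) Yu.
- split=> // [v le Av Xv].
  by split=> // u [_ _ _ E]; lia.
exists z.
  apply: runs_le Hz => v; rewrite -big_distrr big_split /= mulnC leq_mul2r.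
  apply/orP; right; exact: leq_add (sum_delta_le1 n _) (sum_delta_succ_le1 n _).
split=> // v.
- by move=> H; apply: I1; left.
- by move=> Av Xv; have [|H _] := I3 v _ Av Xv; [exact: ltnW (dep_lt v) | apply: H].
- by move=> u Av Xv; have [|_ H] := I3 v _ Av Xv; [exact: ltnW (dep_lt v) | apply: H].
Qed.

End Down.

(** * Casts from a single source to the root *)

Section Climb.
Variables (act : 'I_n -> bool) (h : 'I_n -> pkt -> pkt) (x : 'I_n -> option pkt).
Hypothesis Hact : forall u v, cid u = cid v -> act u = act v.
Hypothesis x_uniq : forall u v, cid u = cid v -> x u -> x v -> u = v.

(** With one source per cluster, at most one vertex per depth ever holds a value, so a listening
    parent hears exactly one child. The last two clauses of the invariant carry this, together with
    the fact that holders lie no deeper than the source. *)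
Lemma runs_climb :
  exists2 y, runs adj (n * N.+1) (fun v => climb n N (id v) (dep v) (par v) (act v) (h v) (x v)) y
               (fun v => 2 * act v)
    & [/\ forall v, act v = false -> y v = x v,
          forall v d, x v = Some d -> y v = Some d,
          forall v u, act v -> y v -> parent cid dep par v u -> y u
        & forall v d, y v = Some d -> x v = Some d \/
            exists u d', [/\ adj v u, cid u = cid v, y u = Some d' & d = h u d']].
Proof.
pose I i (y : 'I_n -> option pkt) :=
  [/\ forall v, act v = false \/ dep v < i -> y v = x v,
      forall v d, x v = Some d -> y v = Some d,
      forall v u, i < dep v -> act v -> y v -> parent cid dep par v u -> y u,
      forall v d, y v = Some d -> x v = Some d \/
            exists u d', [/\ adj v u, cid u = cid v, y u = Some d' & d = h u d']
    & (forall v, y v -> exists2 s, x s & cid s = cid v /\ dep v <= dep s) /\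
      (forall u v, cid u = cid v -> dep u = dep v -> y u -> y v -> u = v)].
have [||z Hz [I1 I2 I3 I4 _]] := @runs_loopd _ _ adj _ N.+1
  (fun v i y => bind (chan (iota 0 N.+1)
            (if act v && (dep v == i.+1) then omap (fun d => (par v, h v d)) y else None)
            (if act v && (dep v == i) && ~~ isSome y then Some (id v) else None) NoFeedback)
      (fun f => Done _ (if act v && (dep v == i) && ~~ isSome y then received f else y))) I
  (fun i v => act v * ((dep v == i.+1) + (dep v == i))) n x.
- move=> i y lti [I1 I2 I3 I4 [I5 I6]].
  pose tx v := if act v && (dep v == i.+1) then omap (fun d => (par v, h v d)) (y v) else None.
  pose ls v := if act v && (dep v == i) && ~~ isSome (y v) then Some (id v) else None.
  pose y' v := if act v && (dep v == i) && ~~ isSome (y v) then received (chan_fb adj tx ls v) else y v.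
  have y'E v : act v = false \/ dep v != i -> y' v = y v.
    by rewrite /y'; case=> [->|/negbTE ->] //=; rewrite andbF.
  have y'S v : y v -> y' v = y v by rewrite /y'; case: (y v) => //= d; rewrite andbF.
  have lsE v : act v -> dep v = i -> y v = None -> ls v = Some (id v).
    by move=> Av Ev Yv; rewrite /ls Av Ev eqxx Yv.
  have txE v : dep v = i -> omap fst (tx v) != Some (id v).
    by move=> Ev; rewrite /tx Ev; rewrite (ltn_eqF (ltnSn i)) andbF.
  have txP v q p : tx v = Some (q, p) ->
      exists d, [/\ act v, dep v = i.+1, y v = Some d, q = par v & p = h v d].
    rewrite /tx; case: ifP => // /andP [Av /eqP Ev]; case: (y v) => //= d [<- <-].
    by exists d.
  have new v d : y v = None -> y' v = Some d ->
      exists u d', [/\ act v, dep v = i, parent cid dep par u v, y u = Some d' & d = h u d'].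
    move=> Yv; rewrite /y' Yv andbT; case: ifP => // /andP [Av /eqP Ev] E.
    have [u au] := chan_received_inv (lsE _ Av Ev Yv) (txE _ Ev) E.
    case/txP => d' [Au Eu Yu Ep Eh]; exists u, d'; split=> //.
    have [|u' Pu'] := @parent_ex u; first by rewrite Eu.
    by rewrite (parent_uniq Ep Pu').
  exists y'.
    apply: (@runs_map _ _ adj _ _ _ (fun v => chan (iota 0 N.+1) (tx v) (ls v) NoFeedback)
      (fun v f => if act v && (dep v == i) && ~~ isSome (y v) then received f else y v)).
    apply: runs_le (@runs_chan _ _ adj _ tx ls _) => [v|v q].
      rewrite /tx /ls; case: (act v) => //=; rewrite mul1n leq_add //.
        by case: (dep v == i.+1) => //; case: (y v).
      by case: (dep v == i) => //=; case: ifP.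
    by rewrite /ls; case: ifP => // _ [<-]; rewrite ltnS.
  split.
  + move=> v H; rewrite y'E; first by apply: I1; case: H => H; [left|right; lia].
    by case: H => H; [left|right; lia].
  + by move=> v d E; rewrite y'S (I2 _ _ E).
  + move=> v u lt Av; have Ev : y' v = y v by rewrite y'E //; right; lia.
    rewrite Ev => Yv Pu; case: (ltngtP (dep v) i.+1) => Hd; first by lia.
      by have Yu := I3 _ _ Hd Av Yv Pu; rewrite y'S.
    have [a1 a2 a3 a4] := Pu.
    case Yu: (y u) => [d'|]; first by rewrite y'S Yu.
    have Au : act u by rewrite (Hact a3).
    have Eu : dep u = i by lia.
    rewrite /y' Au Eu eqxx Yu /=.
    case Yv': (y v) Yv => [d|] // _.
    suff -> : received (chan_fb adj tx ls u) = Some (h v d) by [].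
    apply: (chan_received (lsE _ Au Eu Yu) (txE _ Eu) (u := v)).
    * by rewrite adj_sym.
    * by rewrite /tx Av Hd eqxx Yv' a2.
    * move=> v' p' _ /txP [d' [Av' Ev' Yv2 Ep _]].
      apply: I6; rewrite ?Yv' ?Yv2 ?Ev' //.
      have [|u' Pu'] := @parent_ex v'; first by rewrite Ev'.
      by have [_ _ <- _] := Pu'; rewrite -(parent_uniq Ep Pu').
  + move=> v d E; case Yv: (y v) => [d0|]; last first.
      have [u [d' [Av Ev [b1 b2 b3 b4] Yu Ed]]] := new _ _ Yv E; right; exists u, d'.
      by rewrite adj_sym y'S Yu.
    have Edd : d0 = d by move: E; rewrite y'S Yv // => [[]].
    case: (I4 v d); [by rewrite Yv Edd | by left |].
    by case=> u [d' [b1 b2 b3 b4]]; right; exists u, d'; rewrite y'S b3.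
  (* The strict bound for vertices that just received a value separates them from an old holder at
     depth [i], which can only be the source itself. *)
  have src v : y' v -> exists2 s, x s & cid s = cid v /\ dep v <= dep s /\ (y v = None -> dep v < dep s).
    case Yv: (y v) => [d|].
      by move=> _; have [|s xs [c1 c2]] := I5 v; [rewrite Yv | exists s].
    case E: (y' v) => [d|] // _.
    have [u [d' [Av Ev [b1 b2 b3 b4] Yu Ed]]] := new _ _ Yv E.
    by have [|s xs [c1 c2]] := I5 u; [rewrite Yu | exists s => //; split; [rewrite c1|lia]].
  split=> [v /src [s xs [c1 [c2 _]]]|u v Ec Ed]; first by exists s.
  case Yu: (y u) => [d|]; case Yv: (y v) => [e|].
  + by move=> _ _; apply: I6; rewrite ?Yu ?Yv.
  + move=> Y'u Y'v; have [s xs [c1 [c2 c3]]] := src _ Y'v.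
    have Ev : dep v = i by case E: (y' v) Y'v => [d'|] // _; have [? [? []]] := new _ _ Yv E.
    have xu : x u by rewrite -I1 ?Yu //; right; lia.
    by have := c3 Yv; rewrite (@x_uniq s u) ?c1 //; lia.
  + move=> Y'u Y'v; have [s xs [c1 [c2 c3]]] := src _ Y'u.
    have Eu : dep u = i by case E: (y' u) Y'u => [d'|] // _; have [? [? []]] := new _ _ Yu E.
    have xv : x v by rewrite -I1 ?Yv //; right; lia.
    by have := c3 Yu; rewrite (@x_uniq s v) ?c1 //; lia.
  + case Y'u: (y' u) => [d|] // _; case Y'v: (y' v) => [e|] // _.
    have [u1 [d1 [_ _ Pu Yu1 _]]] := new _ _ Yu Y'u.
    have [v1 [e1 [_ _ Pv Yv1 _]]] := new _ _ Yv Y'v.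
    have E : u1 = v1.
      case: Pu => _ _ p1 p2; case: Pv => _ _ q1 q2.
      by apply: I6; rewrite ?Yu1 ?Yv1 //; [rewrite -p1 -q1 | lia].
    by case: Pu => _ Eid _ _; apply: parent_uniq Pv; rewrite -E.
- split=> //.
  + by move=> v u H; have := dep_lt v; lia.
  + by move=> v d ->; left.
  + by split=> [v xv|u v Ec _]; [exists v | exact: x_uniq].
exists z.
  apply: runs_le Hz => v; rewrite -big_distrr big_split /= mulnC leq_mul2r.
  apply/orP; right; exact: leq_add (sum_delta_succ_le1 n _) (sum_delta_le1 n _).
split=> // v.
- by move=> H; apply: I1; left.
- by move=> u Av zv Pu; apply: (I3 v) => //; case: Pu => _ _ _ <-.
Qed.

End Climb.

(** The values end up nonincreasing towards the root while each remains the key of some cluster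
    member, so the root holds the cluster minimum. *)
Lemma runs_gather w (key : 'I_n -> nat) :
  (forall v, key v < 2 ^ w) ->
  exists2 y, runs adj (n * (w * (N.+1 * 2 ^ w)))
               (fun v => gather n N w (id v) (dep v) (par v) (key v)) y (fun v => 2 * w)
    & [/\ forall v, exists2 u, cid u = cid v & y v = key u,
          forall v, y v <= key v
        & forall v u, parent cid dep par v u -> y u <= y v].
Proof.
move=> Hk.
pose I i (y : 'I_n -> nat) :=
  [/\ forall v, exists2 u, cid u = cid v & y v = key u,
      forall v, y v <= key v
    & forall v u, i <= dep u -> parent cid dep par v u -> y u <= y v].
have [||z Hz [I1 I2 I3]] := @runs_loopd _ _ adj _ (w * (N.+1 * 2 ^ w))
  (fun v i y => bind (trie N.+1 w (if dep v == i.+1 then Some (par v, y) else None)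
            (if dep v == i then Some (id v) else None))
      (fun r => Done _ (if dep v == i then minn y r else y))) I
  (fun i v => w * ((dep v == i.+1) + (dep v == i))) n key.
- move=> i y lti [I1 I2 I3].
  have yk v : y v < 2 ^ w by have [u _ ->] := I1 v.
  pose gk v := if dep v == i.+1 then Some (par v, y v) else None.
  pose gl v := if dep v == i then Some (id v) else None.
  have gkP u g k : gk u = Some (g, k) -> [/\ dep u = i.+1, g = par u & k = y u].
    by rewrite /gk; case: eqP => // E [<- <-].
  have [||r Hr Sr] := @runs_trie _ adj N.+1 w gk gl.
  + by move=> u g k /gkP [_ _ ->].
  + by move=> v g; rewrite /gl; case: eqP => // _ [<-]; rewrite ltnS.
  have glE v : dep v = i -> gl v = Some (id v) by rewrite /gl => ->; rewrite eqxx.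
  exists (fun v => if dep v == i then minn (y v) (r v) else y v).
    apply: (@runs_map _ _ adj _ _ _ (fun v => trie N.+1 w (gk v) (gl v))
      (fun v r => if dep v == i then minn (y v) r else y v)).
    apply: runs_le Hr => v; rewrite leq_mul2l /gk /gl.
    by case: (dep v == i.+1); case: (dep v == i); rewrite orbT.
  split.
  + move=> v; case: eqP => [Ev|_]; last exact: I1.
    have [r1 r2 r3] := Sr _ _ (glE _ Ev).
    rewrite /minn; case: ltnP => H; first exact: I1.
    (* If no child made an offer, [r v] is the largest [w]-bit value; being at most [y v] here, it
       equals [y v]. *)
    case: r3 => [r3|]; first by have E : r v = y v; [have := yk v; lia | rewrite E; apply: I1].
    case=> u [au /gkP [Eu Ep ->]].
    have [|u' Pu] := @parent_ex u; first by rewrite Eu.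
    have [u0 c0 k0] := I1 u; exists u0 => //.
    by rewrite c0 (parent_uniq Ep Pu); case: Pu => _ _ -> _.
  + move=> v; case: eqP => _ //; exact: leq_trans (geq_minl _ _) (I2 v).
  + move=> v u le Pu; have [a1 a2 a3 a4] := Pu.
    rewrite (_ : dep v == i = false); last by apply/eqP; lia.
    case: eqP => [Eu|ne]; last by apply: I3 => //; lia.
    have [r1 r2 r3] := Sr _ _ (glE _ Eu).
    apply: leq_trans (geq_minr _ _) _; apply: r2; exists v.
    by rewrite adj_sym a1 orbT /gk -a4 Eu eqxx a2.
- split=> // [v|v u]; [by exists v | by have := dep_lt u; lia].
exists z; last by split=> // v u; apply: I3.
apply: runs_le Hz => v; rewrite -big_distrr big_split /= mulnC leq_mul2r.
by apply/orP; right; exact: leq_add (sum_delta_succ_le1 n _) (sum_delta_le1 n _).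
Qed.

Lemma runs_cluster_min w (key : 'I_n -> nat) :
  (forall v, key v < 2 ^ w) ->
  exists2 r, runs adj (n * (w * (N.+1 * 2 ^ w)) + n * N.+1)
               (fun v => cluster_min n N w (id v) (dep v) (par v) (key v)) r (fun v => 2 * w + 2)
    & [/\ forall v u, cid u = cid v -> r v <= key u,
          forall v, exists2 u, cid u = cid v & r v = key u
        & forall u v, cid u = cid v -> r u = r v].
Proof.
move=> Hk; have [y Hy [y1 y2 y3]] := runs_gather Hk.
pose x v : option pkt := if dep v == 0 then Some (y v, 0, None) else None.
have [|z Hz [_ z1 _ z3]] := @runs_down (fun=> true) (fun=> Datatypes.id) x; first by [].
have zE k v r : dep v = k -> dep r = 0 -> cid r = cid v -> z v = Some (y r, 0, None).
  elim: k v => [|k IH] v Ev Er Ec.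
    have -> : r = v by case: wf => _; apply.
    by apply: z1; rewrite /x Ev eqxx.
  have [|u Pu] := @parent_ex v; first by rewrite Ev.
  have [_ _ a3 a4] := Pu.
  rewrite (z3 v u) // ?(IH u) ?a3 //; first by lia.
  by rewrite /x Ev.
have rE v r : dep r = 0 -> cid r = cid v -> (if z v is Some p then p.1.1 else 0) = y r.
  by move=> Er Ec; rewrite (zE _ _ _ (erefl _) Er Ec).
have low k v r : dep v = k -> dep r = 0 -> cid r = cid v -> y r <= y v.
  elim: k v => [|k IH] v Ev Er Ec.
    by have -> : r = v by case: wf => _; apply.
  have [|u Pu] := @parent_ex v; first by rewrite Ev.
  have [_ _ a3 a4] := Pu.
  by apply: leq_trans (y3 _ _ Pu); apply: IH; rewrite ?a3 //; lia.
exists (fun v => if z v is Some p then p.1.1 else 0).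
  apply: (runs_bind Hy); apply: runs_le (runs_map _ Hz) => v; exact: leqnn.
split=> [v u Ec|v|u v Ec].
- have [r Er Ecr] := root_ex v; rewrite (rE _ _ Er Ecr).
  apply: leq_trans (y2 u); exact: (low _ _ _ (erefl _) Er (etrans Ecr (esym Ec))).
- by have [r Er Ecr] := root_ex v; rewrite (rE _ _ Er Ecr); have [u cu ->] := y1 r; exists u; rewrite ?cu.
- by have [r Er Ecr] := root_ex v; rewrite (rE _ _ Er Ecr) (rE u r) ?Ec.
Qed.

(** * Re-rooting a cluster at a selected vertex *)

Section Reroot.
Variables (act sel : 'I_n -> bool) (msg : 'I_n -> option nat).
Hypothesis Hact : forall u v, cid u = cid v -> act u = act v.
Hypothesis Hsel : forall v, sel v -> act v.
Hypothesis sel_ex : forall v, act v -> exists2 s, sel s & cid s = cid v.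
Hypothesis sel_uniq : forall u v, cid u = cid v -> sel u -> sel v -> u = v.

(** The climb gives the old root a value, so the downward cast reaches the whole cluster. Both casts
    use the same hop map, so the last clause yields the new parent relation whichever cast delivered
    the value. It also lets the message be traced back to the selected vertex. *)
Lemma runs_reroot :
  exists2 z, runs adj (n * N.+1 + n * N.+1)
               (fun v => reroot n N (id v) (dep v) (par v) (act v) (sel v) (msg v)) z
               (fun v => 4 * act v)
    & [/\ forall v, act v = false -> z v = None,
          forall v, act v -> z v,
          forall v, sel v -> z v = Some (0, 0, msg v)
        & forall v d p m, z v = Some (d, p, m) ->
            (sel v /\ d = 0) \/
            exists u d' p', [/\ adj v u, id u = p, cid u = cid v, z u = Some (d', p', m) & d = d'.+1]].
Proof.
pose x v : option pkt := if sel v then Some (0, 0, msg v) else None.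
pose h v := reroot_hop (id v).
have x_uniq u v : cid u = cid v -> x u -> x v -> u = v.
  by rewrite /x => Ec; case: ifP => // su _; case: ifP => // sv _; apply: sel_uniq.
have [y Hy [y1 y2 y3 y4]] := runs_climb h Hact x_uniq.
have [z Hz [z1 z2 z3 z4]] := runs_down h y Hact.
have xE v : sel v -> x v = Some (0, 0, msg v) by rewrite /x => ->.
have yroot k s r : dep s = k -> act s -> y s -> dep r = 0 -> cid r = cid s -> y r.
  elim: k s => [|k IH] s Es As ys Er Ec.
    by have -> : r = s by case: wf => _; apply.
  have [|u Pu] := @parent_ex s; first by rewrite Es.
  have [_ _ a3 a4] := Pu.
  by apply: (IH u); rewrite ?a3 ?(Hact a3) //; [lia | apply: y3 Pu].
have zall k v : dep v = k -> act v -> z v.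
  elim: k v => [|k IH] v Ev Av.
    have [s ss sc] := sel_ex Av.
    have : y v.
      apply: (yroot _ s v (erefl _)); rewrite ?(Hact sc) //.
      by rewrite (y2 _ _ (xE _ ss)).
    by case Yv: (y v) => [d|] // _; rewrite (z2 _ _ Yv).
  case Yv: (y v) => [d|]; first by rewrite (z2 _ _ Yv).
  have [|u Pu] := @parent_ex v; first by rewrite Ev.
  have [_ _ a3 a4] := Pu.
  rewrite (z4 _ _ Av Yv Pu); have : z u by apply: IH; rewrite ?(Hact a3) //; lia.
  by case: (z u).
exists z.
  by apply: runs_le (runs_bind Hy Hz) => v; lia.
have xN v : act v = false -> x v = None.
  by move=> Av; rewrite /x; case: ifP => // /Hsel; rewrite Av.
split.
- by move=> v Av; rewrite z1 // y1 // xN.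
- by move=> v; apply: zall.
- by move=> v sv; apply/z2/y2/xE.
move=> v d p m Zv.
case Yv: (y v) => [q|].
  have Eq : q = (d, p, m) by move: Zv; rewrite (z2 _ _ Yv) => [[]].
  case: (y4 _ _ Yv) => [|[u [[[d' p'] m'] [a1 a2 a3 a4]]]].
    by rewrite /x; case: ifP => // sv [E]; left; split=> //; move: Eq; rewrite -E; case.
  right; exists u, d', p'; move: a4; rewrite Eq /h /reroot_hop /= => [[E1 E2 E3]].
  by rewrite a2 E1 E2 E3 (z2 _ _ a3).
have Av : act v by case E: (act v) => //; rewrite z1 ?Yv in Zv.
case Ev: (dep v) => [|k]; first by rewrite z3 in Zv.
have [|u Pu] := @parent_ex v; first by rewrite Ev.
have [a1 a2 a3 a4] := Pu.
move: Zv; rewrite (z4 _ _ Av Yv Pu); case Zu: (z u) => [[[d' p'] m']|] //= [E1 E2 E3].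
by right; exists u, d', p'; rewrite Zu E1 E2 E3.
Qed.

End Reroot.

End Casts.

(** * Merging clusters *)

(* In frame [k] the vertices of cluster [k] announce their new cluster and depth;
   a cluster that hooks onto cluster [k] then shifts its own depths accordingly. *)
Definition merge_clusters (n N idv cid dep par : nat) (hook : bool) (M : nat) (sel : bool) (wt : nat)
    : proc pkt (nat * nat) :=
  loopu 0 N.+1 (fun k st =>
    bind (chan (iota 0 N.+1) (if cid == k then Some (idv, (st.1, st.2, None)) else None)
            (if sel && (M == k) then Some wt else None) NoFeedback) (fun f =>
    bind (down n N idv dep par (hook && (M == k)) id
            (if sel && (M == k) then omap (fun p => (p.1.1, p.1.2.+1, None)) (received f) else None))
      (fun z => Done _ (if z is Some p then (p.1.1, dep + p.1.2) else st)))) (cid, dep).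

Section Merge.
Variables (n N : nat) (adj : rel 'I_n) (id : 'I_n -> nat).
Hypothesis id_inj : injective id.
Hypothesis id_le : forall v, id v <= N.
Variables cid dep par : 'I_n -> nat.
Hypothesis wf : wf_clusters adj id cid dep par.
Variables (hook sel : 'I_n -> bool) (M wt : 'I_n -> nat).
Hypothesis hook_cid : forall u v, cid u = cid v -> hook u = hook v.
Hypothesis M_cid : forall u v, cid u = cid v -> M u = M v.
Hypothesis M_le : forall v, hook v -> M v <= N.
Hypothesis M_neq : forall v, hook v -> M v <> cid v.
Hypothesis hook_order : forall v w, hook v -> cid w = M v -> hook w -> M w < cid w.
Hypothesis selP : forall v, sel v = hook v && (dep v == 0).
Hypothesis wtP : forall v, sel v -> exists2 w, adj v w & id w = wt v /\ cid w = M v.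

(** The root of a hooking cluster is its attaching vertex, so adding one more than the target's
    depth to all depths of the cluster keeps the tree relation and hangs it below the target. The
    energy 4 is one slot in the cluster's own frame and three in that of its target: one to listen,
    two for the downward cast. *)
Lemma runs_merge_clusters :
  exists2 s, runs adj (N.+1 * (N.+1 + n * N.+1))
               (fun v => merge_clusters n N (id v) (cid v) (dep v) (par v) (hook v) (M v) (sel v) (wt v)) s
               (fun=> 4)
    & [/\ wf_clusters adj id (fun v => (s v).1) (fun v => (s v).2)
            (fun v => if sel v then wt v else par v),
          forall v, hook v = false -> s v = (cid v, dep v)
        & forall v, hook v -> 0 < (s v).2 /\ exists2 w, cid w = M v & (s v).1 = (s w).1].
Proof.
pose par' v := if sel v then wt v else par v.
(* Before frame [k] a hooking cluster is settled when its target label is below [k]. The witnesses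
   are recorded as settled or not hooking, so later frames leave them unchanged. *)
pose I k (s : 'I_n -> nat * nat) :=
  [/\ forall v, hook v && (M v < k) = false -> s v = (cid v, dep v),
      forall v, hook v && (M v < k) -> 0 < (s v).2 /\ exists u,
        [/\ parent adj id (fun v => (s v).1) (fun v => (s v).2) par' v u & hook u -> M u < k]
    & forall v, hook v && (M v < k) -> exists w,
        [/\ cid w = M v, (s v).1 = (s w).1 & hook w -> M w < k]].
have [||s Hs [I1 I2 I3]] := @runs_loopu _ _ adj _ (N.+1 + n * N.+1)
  (fun v k st =>
    bind (chan (iota 0 N.+1) (if cid v == k then Some (id v, (st.1, st.2, None)) else None)
            (if sel v && (M v == k) then Some (wt v) else None) NoFeedback) (fun f =>
    bind (down n N (id v) (dep v) (par v) (hook v && (M v == k)) Datatypes.id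
            (if sel v && (M v == k) then omap (fun p => (p.1.1, p.1.2.+1, None)) (received f) else None))
      (fun z => Done _ (if z is Some p then (p.1.1, dep v + p.1.2) else st)))) I
  (fun k v => (cid v == k) + 3 * (M v == k)) N.+1 (fun v => (cid v, dep v)).
- move=> k s ltk [I1 I2 I3].
  pose tx v : option (nat * pkt) := if cid v == k then Some (id v, ((s v).1, (s v).2, None)) else None.
  pose ls v := if sel v && (M v == k) then Some (wt v) else None.
  pose act v := hook v && (M v == k).
  pose x v : option pkt := if sel v && (M v == k)
    then omap (fun p : pkt => (p.1.1, p.1.2.+1, None)) (received (chan_fb adj tx ls v)) else None.
  have act_cid u v : cid u = cid v -> act u = act v.
    by move=> E; rewrite /act (hook_cid E) (M_cid E).
  have Hchan : runs adj N.+1 (fun v => chan (iota 0 N.+1) (tx v) (ls v) NoFeedback) (chan_fb adj tx ls)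
     (fun v => isSome (tx v) + isSome (ls v)).
    apply: runs_chan => v q; rewrite /ls; case: ifP => // /andP [sv _] [<-].
    by have [w _ [<- _]] := wtP sv; rewrite ltnS.
  have [z Hz [z1 z2 z3 z4]] := runs_down id_inj id_le wf (fun=> Datatypes.id) x act_cid.
  exists (fun v => if z v is Some p then (p.1.1, dep v + p.1.2) else s v).
    apply: (@runs_le _ _ adj _ _ _ _ (fun v => (isSome (tx v) + isSome (ls v)) + 2 * act v)) => [v|].
      rewrite /tx /ls /act -addnA leq_add //; first by case: (cid v == k).
      rewrite selP; case: (hook v) => //=; case: (M v == k); case: (dep v == 0) => //.
    apply: runs_bind Hchan _.
    exact: (runs_map (fun v z => if z is Some p then (p.1.1, dep v + p.1.2) else s v) Hz).
  have xs v : sel v -> M v = k -> exists w,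
      [/\ adj v w, id w = wt v, cid w = k & x v = Some ((s w).1, (s w).2.+1, None)].
    move=> sv Mv; have [w aw [Ew cw]] := wtP sv; exists w; split=> //; first by rewrite cw.
    rewrite /x sv Mv eqxx /=.
    have Lv : ls v = Some (wt v) by rewrite /ls sv Mv eqxx.
    have cv : cid v == k = false.
      by apply/eqP => E; apply: (@M_neq v); [move: sv; rewrite selP => /andP [] | rewrite Mv].
    have Tv : omap fst (tx v) != Some (wt v) by rewrite /tx cv.
    have -> // : received (chan_fb adj tx ls v) = Some ((s w).1, (s w).2, None).
    apply: (chan_received Lv Tv aw); first by rewrite /tx cw Mv eqxx Ew.
    by move=> w' p _; rewrite /tx; case: ifP => // _ [E _]; apply: id_inj; rewrite E.
  have xN v : sel v = false -> x v = None by rewrite /x => ->.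
  have zN v : act v = false -> z v = None.
    by move=> Av; rewrite z1 // /x selP; move: Av; rewrite /act; case: (hook v) => //= ->; rewrite andbF.
  have zS v : act v -> exists r w,
      [/\ sel r, cid r = cid v & [/\ adj r w, id w = wt r, cid w = k & z v = Some ((s w).1, (s w).2.+1, None)]].
    move=> Av; have [r Er Ec] := root_ex wf v.
    have Ar : act r by rewrite (act_cid _ _ Ec).
    have sr : sel r by rewrite selP Er eqxx andbT; case/andP: Ar.
    have [w [b1 b2 b3 b4]] := xs _ sr (eqP (proj2 (andP Ar))).
    exists r, w; split=> //; split=> //.
    move: {2}(dep v) (erefl (dep v)) => d; elim: d v Av Ec => [|d IH] v Av Ec Ev.
      have -> : v = r by case: wf => _; apply.
      exact: z2.
    have [|u Pu] := parent_ex wf (v := v); first by rewrite Ev.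
    have [_ _ a3 a4] := Pu.
    rewrite (z4 v u) ?IH //; [by rewrite (act_cid _ _ a3) | by rewrite a3 | by lia |].
    by apply: xN; rewrite selP Ev andbF.
  pose s' v := if z v is Some p then (p.1.1, dep v + p.1.2) else s v.
  have s'N v : act v = false -> s' v = s v by move=> Av; rewrite /s' zN.
  have ltS v : hook v && (M v < k.+1) = act v || (hook v && (M v < k)).
    by rewrite /act ltnS leq_eqVlt andb_orr.
  have oldN v : (hook v -> M v < k) -> act v = false.
    by rewrite /act; case: (hook v) => //= H; rewrite (ltn_eqF (H isT)).
  (* By [hook_order], a target that hooks itself does so onto a smaller label, hence in an earlier
     frame: what it announces in frame [k] is final. *)
  have done_w w r : cid w = k -> sel r -> M r = k -> hook w -> M w < k.
    move=> cw; rewrite selP => /andP [hr _] Mr hw.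
    by rewrite -cw; apply: (hook_order hr); rewrite ?Mr.
  change (I k.+1 s'); split.
  + move=> v; rewrite ltS => /norP [/negbTE Av /negbTE H].
    by rewrite s'N // I1.
  + move=> v; rewrite ltS; case Av: (act v) => /= H.
      have [r [w [sr Ec [b1 b2 b3 b4]]]] := zS _ Av.
      have Mr : M r = k by rewrite (M_cid Ec); apply/eqP; case/andP: Av.
      have Dw := done_w _ _ b3 sr Mr.
      have Ew : s' w = s w by rewrite s'N ?oldN.
      rewrite {1}/s' b4 /=; split; first by lia.
      case Ev: (dep v) => [|d].
        have Er : v = r.
          by case: wf => _; apply => //; move: sr; rewrite selP => /andP [_ /eqP].
        exists w; split; last by move/Dw; lia.
        rewrite /parent /= Ew /s' b4 /par' Er sr; split=> //=.
        by rewrite -Er Ev.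
      have [|u Pu] := parent_ex wf (v := v); first by rewrite Ev.
      have [a1 a2 a3 a4] := Pu.
      have Au : act u by rewrite (act_cid _ _ a3).
      have [r' [w' [sr' Ec' [b1' b2' b3' b4']]]] := zS _ Au.
      have Er : r' = r.
        case: wf => _; apply; [by move: sr'; rewrite selP => /andP [_ /eqP] | by move: sr; rewrite selP => /andP [_ /eqP] |].
        by rewrite Ec' a3 Ec.
      have Ew' : w' = w by apply: id_inj; rewrite b2' b2 Er.
      exists u; split; last by case/andP: Au => _ /eqP -> _.
      rewrite /parent /= /s' b4 b4' Ew' /par' selP Ev andbF; split=> //=.
      by rewrite -addSn a4 Ev.
    have [p1 [u [[a1 a2 a3 a4] Du]]] := I2 _ H.
    rewrite s'N //; split=> //; exists u; split; last by move/Du; lia.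
    by rewrite /parent /= !s'N // oldN.
  + move=> v; rewrite ltS; case Av: (act v) => /= H.
      have [r [w [sr Ec [b1 b2 b3 b4]]]] := zS _ Av.
      have Mr : M r = k by rewrite (M_cid Ec); apply/eqP; case/andP: Av.
      have Dw := done_w _ _ b3 sr Mr.
      exists w; split; [|by rewrite {1}/s' b4 s'N ?oldN | by move/Dw; lia].
      by rewrite b3 -(M_cid Ec) Mr.
    have [w [c1 c2 Dw]] := I3 _ H.
    by exists w; rewrite (s'N _ Av) (s'N w) ?oldN //; split=> // /Dw; lia.
- by split=> [//|v|v]; rewrite ltn0 andbF.
have hookE v : hook v && (M v < N.+1) = hook v.
  by case E: (hook v) => //=; rewrite ltnS M_le.
exists s.
  apply: runs_le Hs => v; rewrite big_split -big_distrr /=.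
  have /= := sum_delta_le1 N.+1 (cid v); have /= := sum_delta_le1 N.+1 (M v); lia.
split.
- split=> [v|u v].
    case E: (hook v) => p; first by have [|_ [u [Pu _]]] := I2 v; [rewrite hookE | exists u].
    move: p; rewrite I1 ?hookE //= => p.
    have [u [a1 a2 a3 a4]] := parent_ex wf p.
    have Hu : hook u = false by rewrite (hook_cid a3).
    by exists u; rewrite /parent !I1 ?hookE //= selP E.
  (* Hooked clusters have positive depth everywhere, so the new roots are old roots with their old
     labels. *)
  have H w : (s w).2 = 0 -> hook w = false.
    by case E: (hook w) => // E0; have [] := I2 w; rewrite ?hookE // E0.
  have D w : (s w).2 = 0 -> s w = (cid w, dep w).
    by move/H=> Hw; apply: I1; rewrite hookE.
  move=> E1 E2; have F1 := D _ E1; have F2 := D _ E2.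
  rewrite F1 in E1 *; rewrite F2 in E2 *.
  by case: wf => _; apply.
- by move=> v H; rewrite I1 ?hookE.
- move=> v H; have [|p _] := I2 v; first by rewrite hookE.
  by have [|w [c1 c2 _]] := I3 v; [rewrite hookE | split=> //; exists w].
Qed.

End Merge.

(* With [up], only clusters that have a smaller neighbouring cluster offer
   themselves, and a cluster hooks upwards onto the least offer: this catches
   exactly the local minima.  Without [up], every cluster hooks onto its least
   neighbour if that one is smaller. *)
Definition hook_round (n N idv : nat) (up : bool) (st : nat * nat * nat)
    : proc pkt (nat * nat * nat) :=
  let: (cid, dep, par) := st in
  let w := (lg N).+2 in
  bind (trie 1 w (Some (0, cid)) (Some 0)) (fun a =>
  bind (cluster_min n N w idv dep par a) (fun m =>
  bind (trie 1 (w + w) (if ~~ up || (m < cid) then Some (0, cid * 2 ^ w + idv) else None) (Some 0))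
    (fun nb =>
  bind (cluster_min n N w idv dep par (nb %/ 2 ^ w)) (fun M =>
  let hook := if up then (cid < M) && (M <= N) else M < cid in
  bind (cluster_min n N w idv dep par
          (if hook && (nb %/ 2 ^ w == M) then idv else (2 ^ w).-1)) (fun u =>
  let sel := hook && (u == idv) in
  bind (reroot n N idv dep par hook sel None) (fun z =>
  let dep1 := if z is Some p then p.1.1 else dep in
  let par1 := if z is Some p then p.1.2 else par in
  bind (merge_clusters n N idv cid dep1 par1 hook M sel (nb %% 2 ^ w)) (fun s =>
  Done _ (s.1, s.2, if sel then nb %% 2 ^ w else par1)))))))).

Definition cluster_min_time (n N w : nat) : nat := n * (w * (N.+1 * 2 ^ w)) + n * N.+1.

Definition hook_round_time (n N : nat) : nat :=
  let w := (lg N).+2 in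
  w * (1 * 2 ^ w) + (cluster_min_time n N w + ((w + w) * (1 * 2 ^ (w + w)) +
  (cluster_min_time n N w + (cluster_min_time n N w +
  ((n * N.+1 + n * N.+1) + N.+1 * (N.+1 + n * N.+1)))))).

(** * One round of hooking *)

Section Round.
Variables (n N : nat) (adj : rel 'I_n) (id : 'I_n -> nat).
Hypothesis adj_sym : symmetric adj.
Hypothesis id_inj : injective id.
Hypothesis id_le : forall v, id v <= N.

Definition foreign (cid : 'I_n -> nat) (v : 'I_n) (c : nat) : Prop :=
  exists x y, [/\ cid x = cid v, adj x y, cid y = c & c <> cid v].

(* [M] is the target of a hooking cluster. *)
Definition hooks (up : bool) (cid : 'I_n -> nat) (hook : 'I_n -> bool) (M : 'I_n -> nat) : Prop :=
  [/\ forall u v, cid u = cid v -> hook u = hook v,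
      forall v, hook v -> foreign cid v (M v) /\ forall c, foreign cid v c -> M v <= c,
      forall v, hook v -> if up then cid v < M v else M v < cid v
    & forall v c, hook v = false -> foreign cid v c ->
        if up then exists2 c', foreign cid v c' & c' < cid v else cid v < c].

Variables cid dep par : 'I_n -> nat.
Hypothesis wf : wf_clusters adj id cid dep par.
Hypothesis cid_le : forall v, cid v <= N.

(** * Which clusters hook, and onto which target *)

Section Target.
Variables (w : nat) (up : bool) (a m nb M : 'I_n -> nat).
Hypothesis N_lt : N.+1 < 2 ^ w.
Hypothesis a_spec : forall v,
  [/\ a v < 2 ^ w, (forall k, offers adj (fun u => Some (0, cid u)) v 0 k -> a v <= k)
    & a v = (2 ^ w).-1 \/ offers adj (fun u => Some (0, cid u)) v 0 (a v)].
Hypothesis m_spec : 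
  [/\ forall v u, cid u = cid v -> m v <= a u,
          forall v, exists2 u, cid u = cid v & m v = a u
        & forall u v, cid u = cid v -> m u = m v].
Let snd v := ~~ up || (m v < cid v).
(** Label and identifier share one key, label in the high bits: the minimum selects the least label
    and also names a concrete neighbour carrying it. *)
Let gk v := if snd v then Some (0, cid v * 2 ^ w + id v) else None.
Hypothesis nb_spec : forall v,
  [/\ nb v < 2 ^ (w + w), (forall k, offers adj gk v 0 k -> nb v <= k)
    & nb v = (2 ^ (w + w)).-1 \/ offers adj gk v 0 (nb v)].
Hypothesis M_spec : 
  [/\ forall v u, cid u = cid v -> M v <= nb u %/ 2 ^ w,
          forall v, exists2 u, cid u = cid v & M v = nb u %/ 2 ^ w
        & forall u v, cid u = cid v -> M u = M v].

Let id_lt v : id v < 2 ^ w.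
Proof. by have := id_le v; lia. Qed.

Lemma least_le v x y : cid x = cid v -> (y == x) || adj x y -> m v <= cid y.
Proof.
case: m_spec => m1 _ _ Ec Hy; apply: leq_trans (m1 _ _ Ec) _.
by have [_ H _] := a_spec x; apply: H; exists y.
Qed.

Lemma least_ex v : exists x y, [/\ cid x = cid v, (y == x) || adj x y & m v = cid y].
Proof.
case: m_spec => _ m2 _; have [u Eu ->] := m2 v.
have [_ H [E|[y [Hy [<-]]]]] := a_spec u; last by exists u, y.
have : a u <= cid u by apply: H; exists u; rewrite eqxx.
by rewrite E; have := cid_le u; lia.
Qed.

Lemma target_le v x y : cid x = cid v -> (y == x) || adj x y -> snd y -> M v <= cid y.
Proof.
case: M_spec => M1 _ _ Ec Hy Sy; apply: leq_trans (M1 _ _ Ec) _.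
have [_ H _] := nb_spec x.
have : nb x <= cid y * 2 ^ w + id y by apply: H; exists y; rewrite /gk Sy.
by move/(leq_div2r (2 ^ w)); rewrite divnMDl ?expn_gt0 // (divn_small (id_lt y)) addn0.
Qed.

(** The default [2 ^ (w + w) - 1] has high part [2 ^ w - 1], which exceeds [N]; a high part at most
    [N] therefore comes from a real offer. *)
Lemma nb_offer x : nb x %/ 2 ^ w <= N ->
  exists y, [/\ (y == x) || adj x y, snd y, nb x %/ 2 ^ w = cid y & nb x %% 2 ^ w = id y].
Proof.
move=> le; have [_ _ [E|[y [Hy]]]] := nb_spec x.
  have : (2 ^ (w + w)).-1 %/ 2 ^ w = (2 ^ w).-1.
    have -> : (2 ^ (w + w)).-1 = (2 ^ w).-1 * 2 ^ w + (2 ^ w).-1.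
      by rewrite expnD; case: (2 ^ w) N_lt => // k _; nia.
    by rewrite divnMDl ?expn_gt0 // divn_small ?addn0 //; lia.
  by move=> E'; move: le; rewrite E E'; lia.
rewrite /gk; case: ifP => // Sy [<-]; exists y.
by rewrite Sy divnMDl ?expn_gt0 // (divn_small (id_lt y)) addn0 modnMDl modn_small.
Qed.

Let hook v := if up then (cid v < M v) && (M v <= N) else M v < cid v.

Lemma snd_cid u v : cid u = cid v -> snd u = snd v.
Proof. by case: m_spec => _ _ m3 E; rewrite /snd (m3 _ _ E) E. Qed.

Lemma hook_M_le v : hook v -> M v <= N.
Proof.
rewrite /hook; case: up => [/andP [] //|lt].
by apply: leq_trans (ltnW lt) (cid_le v).
Qed.

(** With [up], a hooking cluster cannot itself offer, since [M v] would then be at most [cid v]; so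
    it is a local minimum. All its neighbours then see a smaller label and offer, and [M v] is the
    least of them. Conversely, a local minimum with a foreign neighbour receives an offer and hooks.
    Without [up] everybody offers, and [M v] is the least label in the closed neighbourhood of the
    cluster. *)
Lemma hook_hooks : hooks up cid hook M.
Proof.
have [_ M2 _] := M_spec.
have [m1 m2 m3] := m_spec.
have attained v : M v <= N -> exists x y,
    [/\ cid x = cid v, (y == x) || adj x y, snd y & M v = cid y].
  move=> le; have [x Ex EM] := M2 v.
  have [|y [y1 y2 y3 y4]] := @nb_offer x; first by rewrite -EM.
  by exists x, y; rewrite EM.
have foreignM v : M v <= N -> M v <> cid v -> foreign cid v (M v).
  move=> le ne; have [x [y [Ex Hxy Sy EM]]] := attained _ le.
  exists x, y; split=> //; case/orP: Hxy => // /eqP E.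
  by case: ne; rewrite EM E Ex.
have snd_min v c : up -> hook v -> foreign cid v c -> cid v < c.
  rewrite /hook => -> /andP [lt le] [x [y [Ex Hxy Ey ne]]].
  have nS : snd v = false.
    apply/negP => Sv; have := @target_le v v v erefl _ Sv; rewrite eqxx => /(_ isT).
    by move: lt; lia.
  have : cid v <= m v by move: nS; rewrite /snd; case: up => //=; lia.
  have := @least_le v x y Ex; rewrite Hxy orbT Ey => /(_ isT).
  by move/eqP: ne; lia.
have snd_foreign v x y : cid x = cid v -> adj x y -> cid v < cid y -> snd y.
  move=> Ex Hxy lt; rewrite /snd; apply/orP; right.
  apply: leq_ltn_trans lt; rewrite -Ex; apply: (@least_le y y x) => //.
  by rewrite adj_sym Hxy orbT.
have [_ _ M3] := M_spec.
split.
- by move=> u v E; rewrite /hook (M3 _ _ E) E.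
- move=> v Hv; have le := hook_M_le Hv.
  have ne : M v <> cid v.
    by move: Hv; rewrite /hook; case: up => [/andP [? _]|?]; lia.
  split; first exact: foreignM.
  move=> c Hc; case: (boolP up) => Hup.
    have lt := snd_min _ _ Hup Hv Hc.
    case: Hc lt => x [y [Ex Hxy <- _]] lt.
    by apply: (@target_le v x y Ex); [rewrite Hxy orbT | apply: snd_foreign Ex Hxy lt].
  case: Hc => x [y [Ex Hxy <- _]].
  by apply: (@target_le v x y Ex); [rewrite Hxy orbT | rewrite /snd Hup].
- by move=> v; rewrite /hook; case: up => [/andP []|].
move=> v c; case: (boolP up) => Hup Hv Hc.
  case: (boolP (m v < cid v)) => Hm.
    have [x [y [Ex Hxy Em]]] := least_ex v.
    exists (m v) => //; exists x, y; split=> //; last by lia.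
    by case/orP: Hxy => // /eqP E; move: Hm; rewrite Em E Ex ltnn.
  case: Hc => x [y [Ex Hxy Ey ne]]; exfalso.
  have lt : cid v < cid y.
    have := @least_le v x y Ex; rewrite Hxy orbT => /(_ isT).
    by move/eqP: ne; rewrite -Ey; lia.
  have Sy := snd_foreign _ _ _ Ex Hxy lt.
  have := @target_le v x y Ex; rewrite Hxy orbT => /(_ isT Sy) le.
  have leN : M v <= N by apply: leq_trans le (cid_le y).
  have [x' [y' [Ex' Hxy' Sy' EM]]] := attained _ leN.
  have ge : m v <= cid y' by apply: least_le Ex' Hxy'.
  have ne' : cid y' <> cid v.
    by move=> E; move: Sy'; rewrite (snd_cid E) /snd Hup /= (negbTE Hm).
  move: Hv; rewrite /hook Hup leN andbT EM.
  by move/eqP: ne'; lia.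
case: Hc => x [y [Ex Hxy <- ne]].
have : M v <= cid y by apply: (@target_le v x y Ex); [rewrite Hxy orbT | rewrite /snd Hup].
have : cid v <= M v by move: Hv; rewrite /hook (negbTE Hup); lia.
by move: ne; have := ltngtP (cid v) (cid y); lia.
Qed.

End Target.

Lemma runs_hook_round up :
  exists s hook M,
    [/\ runs adj (hook_round_time n N)
           (fun v => hook_round n N (id v) up (cid v, dep v, par v)) s
           (fun=> 12 * (lg N).+2 + 14),
        wf_clusters adj id (fun v => (s v).1.1) (fun v => (s v).1.2) (fun v => (s v).2),
        hooks up cid hook M,
        forall v, hook v = false -> (s v).1 = (cid v, dep v)
      & forall v, hook v -> 0 < (s v).1.2 /\ (up -> (s v).1.1 = M v)].
Proof.
(* Two bits above [lg N] give [N + 1 < 2 ^ w], so the all-ones value differs from every label and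
   identifier and can mean absence. *)
pose w := (lg N).+2.
have N_lt : N.+1 < 2 ^ w.
  have : N < 2 ^ (lg N).+1 by apply: trunc_log_ltn.
  by rewrite [2 ^ w]expnS; lia.
have w_gt0 : 0 < 2 ^ w by rewrite expn_gt0.
have id_lt v : id v < 2 ^ w by have := id_le v; lia.
have [||a Ha Sa] := @runs_trie _ adj 1 w (fun v => Some (0, cid v)) (fun=> Some 0).
- by move=> u g k [_ <-]; have := cid_le u; lia.
- by move=> v g [<-].
have {}Sa v := Sa v 0 erefl.
have a_lt v : a v < 2 ^ w by case: (Sa v).
have [m Hm Sm] := runs_cluster_min adj_sym id_inj id_le wf a_lt.
pose snd v := ~~ up || (m v < cid v).
pose gk v := if snd v then Some (0, cid v * 2 ^ w + id v) else None.
have [||nb Hnb Snb] := @runs_trie _ adj 1 (w + w) gk (fun=> Some 0).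
- move=> u g k; rewrite /gk; case: ifP => // _ [_ <-]; rewrite expnD.
  have := id_lt u; have : (cid u).+1 * 2 ^ w <= 2 ^ w * 2 ^ w.
    by rewrite leq_mul2r; have := cid_le u; lia.
  by rewrite mulSn; lia.
- by move=> v g [<-].
have {}Snb v := Snb v 0 erefl.
have nb_lt v : nb v %/ 2 ^ w < 2 ^ w by rewrite ltn_divLR // -expnD; case: (Snb v).
have [M HM SM] := runs_cluster_min adj_sym id_inj id_le wf nb_lt.
pose hook v := if up then (cid v < M v) && (M v <= N) else M v < cid v.
have Hhook : hooks up cid hook M := hook_hooks N_lt Sa Sm Snb SM.
have M_le v : hook v -> M v <= N := @hook_M_le up M v.
have [M1 M2 M3] := SM.
have [hook_cid h1 h2 _] := Hhook.
(* Several vertices may border the target; the one of least identifier is elected, the others and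
   non-candidates bidding higher. *)
pose key v := if hook v && (nb v %/ 2 ^ w == M v) then id v else (2 ^ w).-1.
have key_lt v : key v < 2 ^ w by rewrite /key; case: ifP => // _; lia.
have [u Hu [u1 u2 u3]] := runs_cluster_min adj_sym id_inj id_le wf key_lt.
pose sel v := hook v && (u v == id v).
have selE v : sel v -> nb v %/ 2 ^ w = M v.
  case/andP => Hv /eqP Eu; have [x Ex] := u2 v.
  rewrite Eu /key; case: ifP => [/andP [_ /eqP E] /id_inj -> //|_ E].
  by have := id_le v; lia.
have sel_hook v : sel v -> hook v by case/andP.
have sel_ex v : hook v -> exists2 s, sel s & cid s = cid v.
  move=> Hv; have [x Ex EM] := M2 v.
  have Hx : hook x by rewrite (hook_cid _ _ Ex).
  have kx : key x = id x by rewrite /key Hx -EM (M3 _ _ Ex) eqxx.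
  have [y Ey Eu] := u2 v.
  have := u1 _ _ Ex; rewrite Eu kx {1}/key; case: ifP => [/andP [Hy _] _|_]; last by have := id_le x; lia.
  exists y => //; rewrite /sel Hy (u3 _ _ Ey) Eu /key Hy.
  case: ifP => [_|]; first exact: eqxx.
  move=> nk; have := u1 _ _ Ex; rewrite Eu kx /key Hy nk.
  by have := id_le x; lia.
have sel_uniq x y : cid x = cid y -> sel x -> sel y -> x = y.
  by move=> E /andP [_ /eqP Ex] /andP [_ /eqP Ey]; apply: id_inj; rewrite -Ex -Ey (u3 _ _ E).
have [z Hz [z1 z2 z3 z4]] :=
  runs_reroot adj_sym id_inj id_le wf (fun=> None) hook_cid sel_hook sel_ex sel_uniq.
pose dep1 v := if z v is Some p then p.1.1 else dep v.
pose par1 v := if z v is Some p then p.1.2 else par v.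
have selP v : sel v = hook v && (dep1 v == 0).
  apply/idP/andP => [sv|[Hv]]; first by rewrite (sel_hook _ sv) /dep1 (z3 _ sv).
  rewrite /dep1; have := z2 _ Hv; case Ez: (z v) => [[[d p] q]|] // _ /=.
  by case: (z4 _ _ _ _ Ez) => [[]|[x [d' [p' [_ _ _ _ ->]]]]].
have wf1 : wf_clusters adj id cid dep1 par1.
  split=> [v|x y].
    rewrite /parent {1}/dep1 /par1; case Ez: (z v) => [[[d p] q]|] /=.
      case: (z4 _ _ _ _ Ez) => [[_ ->] //|[x [d' [p' [a1 a2 a3 a4 E]]]]] _.
      by exists x; rewrite /dep1 a4 Ez E.
    move=> p; have [x [a1 a2 a3 a4]] := parent_ex wf p.
    have nv : hook v = false by case E: (hook v) => //; have := z2 _ E; rewrite Ez.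
    by exists x; rewrite /dep1 Ez (z1 x) // (hook_cid _ _ a3).
  move=> Ex Ey Ec; case Hx: (hook x); have Hy := Hx; rewrite (hook_cid _ _ Ec) in Hy.
    by apply: sel_uniq; rewrite // selP ?Hx ?Hy ?Ex ?Ey.
  move: Ex Ey; rewrite /dep1 !z1 // => Ex Ey.
  by case: wf => _; apply.
have M_neq v : hook v -> M v <> cid v.
  by move=> /h2; case: (up); lia.
(* Without [up] this is the hooking condition of [x]. With [up] a target never hooks: the cluster of
   [v] borders that of [x], so [M x <= cid v < M v = cid x], against [cid x < M x]. *)
have hook_order v x : hook v -> cid x = M v -> hook x -> M x < cid x.
  move=> Hv Ex Hx; have := h2 _ Hx; have := h2 _ Hv; case: (up); last by [].
  move=> lt lt'; exfalso.
  have [[y [y' [a1 a2 a3 a4]]] _] := h1 _ Hv.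
  have [_ H] := h1 _ Hx.
  suff : M x <= cid v by lia.
  by apply: H; exists y', y; rewrite adj_sym a3 Ex; split=> //; lia.
have wtP v : sel v -> exists2 x, adj v x & id x = nb v %% 2 ^ w /\ cid x = M v.
  move=> sv; have Ev := selE _ sv; have Hv := sel_hook _ sv.
  have [|x [x1 x2 x3 x4]] := nb_offer N_lt Snb (x := v); first by rewrite Ev M_le.
  exists x; last by rewrite x4 -x3 Ev.
  case/orP: x1 => // /eqP E; case: (M_neq _ Hv).
  by rewrite -Ev x3 E.
have [s Hs [s1 s2 s3]] := runs_merge_clusters id_inj id_le wf1 hook_cid M3 M_le M_neq hook_order selP wtP.
exists (fun v => ((s v).1, (s v).2, if sel v then nb v %% 2 ^ w else par1 v)), hook, M.
split=> //.
- rewrite /hook_round /hook_round_time -/w.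
  have e_nb v : (w + w) * (isSome (gk v) + 1) <= (w + w) * 2.
    by rewrite leq_mul2l addn1 ltnS leq_b1 orbT.
  have e_z v : 4 * hook v <= 4 by case: (hook v).
  apply: (@runs_le _ _ adj _ _ _ _ (fun v => w * 2 + ((2 * w + 2) + ((w + w) * 2 + ((2 * w + 2) + ((2 * w + 2) + (4 + 4))))))).
    by move=> v; lia.
  apply: (runs_bind Ha); apply: (runs_bind Hm).
  apply: (runs_bind (runs_le e_nb Hnb)).
  apply: (runs_bind HM); apply: (runs_bind Hu).
  apply: (runs_bind (runs_le e_z Hz)).
  exact: (runs_map (fun v s => (s.1, s.2, if sel v then nb v %% 2 ^ w else par1 v)) Hs).
- move=> v Hv; have E : dep1 v = dep v by rewrite /dep1 z1.
  by rewrite s2 //= E.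
move=> v Hv /=; have [p [x Ex Es]] := s3 _ Hv; split=> // Hup.
rewrite Es s2 //; case Hx: (hook x) => //.
by have := hook_order _ _ Hv Ex Hx; have := h2 _ Hx; rewrite Hup; lia.
Qed.

End Round.

(** * Broadcast *)

Section Halving.
Variables (n N : nat) (adj : rel 'I_n) (id : 'I_n -> nat).
Hypothesis adj_sym : symmetric adj.
Hypothesis adj_connected : forall u v : 'I_n, connect adj u v.
Hypothesis id_inj : injective id.
Hypothesis id_le : forall v, id v <= N.

Definition roots (dep : 'I_n -> nat) : {set 'I_n} := [set v | dep v == 0].

Lemma foreign_ex (cid : 'I_n -> nat) u v : cid u <> cid v -> exists c, foreign adj cid u c.
Proof.
move=> ne.
case: (boolP [exists x, [exists y, [&& cid x == cid u, adj x y & cid y != cid u]]]) => [|no].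
  case/existsP=> x /existsP [y /and3P [/eqP Ex Hxy /eqP Ey]].
  by exists (cid y), x, y.
have Hcl : closed adj [pred x | cid x == cid u].
  have step x y : cid x == cid u -> adj x y -> cid y == cid u.
    move=> Ex Hxy; apply/negPn/negP => Ey; case/negP: no.
    by apply/existsP; exists x; apply/existsP; exists y; rewrite Ex Hxy.
  move=> x y Hxy; rewrite !inE; apply/idP/idP => H; apply: step H _ => //.
  by rewrite adj_sym.
have := closed_connect Hcl (adj_connected u v).
by rewrite !inE eqxx => /esym /eqP E; case: ne.
Qed.

(** Every new label is that of a new root, which did not hook and so kept its old label. *)
Lemma cid_le_next cid dep (s : 'I_n -> nat * nat * nat) (hook : 'I_n -> bool) :
  (forall v, cid v <= N) ->
  wf_clusters adj id (fun v => (s v).1.1) (fun v => (s v).1.2) (fun v => (s v).2) ->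
  (forall v, hook v = false -> (s v).1 = (cid v, dep v)) ->
  (forall v, hook v -> 0 < (s v).1.2) ->
  forall v, (s v).1.1 <= N.
Proof.
move=> cle wf s1 s2 v; have [r /= Er <-] := root_ex wf v.
case Hr: (hook r); first by have := s2 _ Hr; rewrite Er.
by rewrite s1 /=.
Qed.

(** Let [R0], [R1], [R2] be the roots initially and after each round. When [R2] has more than one
    element, it is contained in [R0 :&: R1] and also injects into [R0 :\: R1], each survivor being
    sent to a root that hooked onto it in the first round. The two parts are disjoint. *)
Lemma runs_phase cid dep par :
  wf_clusters adj id cid dep par -> (forall v, cid v <= N) ->
  exists s,
    [/\ runs adj (hook_round_time n N + hook_round_time n N)
          (fun v => bind (hook_round n N (id v) true (cid v, dep v, par v)) (hook_round n N (id v) false)) s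
          (fun=> (12 * (lg N).+2 + 14) + (12 * (lg N).+2 + 14)),
        wf_clusters adj id (fun v => (s v).1.1) (fun v => (s v).1.2) (fun v => (s v).2),
        forall v, (s v).1.1 <= N
      & #|roots (fun v => (s v).1.2)| <= 1 \/ 2 * #|roots (fun v => (s v).1.2)| <= #|roots dep|].
Proof.
move=> wf0 cle0.
have [s [hook0 [M0 [Rs wfs [h1 h2 h3 h4] sN sH]]]] := runs_hook_round adj_sym id_inj id_le wf0 cle0 true.
have cle1 : forall v, (s v).1.1 <= N.
  by apply: cid_le_next cle0 wfs sN _ => v /sH [].
have [t [hook1 [M1 [Rt wft [k1 k2 k3 k4] tN tH]]]] := runs_hook_round adj_sym id_inj id_le wfs cle1 false.
exists t; split=> //.
- apply: (runs_bind Rs); apply: runs_weaken Rt => // v.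
  by case: (s v) => [[]].
- by apply: cid_le_next cle1 wft tN _ => v /tH [].
set R0 := roots dep; set R2 := roots _.
pose R1 := roots (fun v => (s v).1.2).
have R1P v : v \in R1 -> hook0 v = false /\ v \in R0.
  rewrite !inE; case Hv: (hook0 v); first by have [] := sH _ Hv; case: ((s v).1.2).
  by rewrite sN.
have R2P v : v \in R2 -> hook1 v = false /\ v \in R1.
  rewrite !inE; case Hv: (hook1 v); first by have [] := tH _ Hv; case: ((t v).1.2).
  by rewrite tN.
case: (leqP #|R2| 1) => [|lt2]; [by left | right].
(* Not hooking in round one, [r] has a neighbour [y] of smaller label. Not hooking in round two, it
   then sees only larger labels, so [y] must have hooked. Its target [M0 y] is at most [cid r] by
   minimality and cannot be smaller, as that label would border [r] in round two. The witness is the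
   old root of the cluster of [y]. *)
have key r : r \in R2 -> exists x, [&& x \in R0 :\: R1 & M0 x == cid r].
  move=> r2; have [r_hook1 r1] := R2P _ r2; have [r_hook0 r0] := R1P _ r1.
  have [r' r'2 ne] : exists2 r', r' \in R2 & r' != r.
    have : R2 :\ r != set0 by rewrite -card_gt0; move: lt2; rewrite (cardsD1 r) r2.
    by case/set0Pn => r' /setD1P [? ?]; exists r'.
  have [c Hc] : exists c, foreign adj cid r c.
    apply: (@foreign_ex _ _ r') => E; case/eqP: ne.
    have [_ /R1P [_]] := R2P _ r'2; move: r0; rewrite !inE => /eqP Er /eqP Er'.
    by case: wf0 => _; apply.
  have [c' [x [y [Ex Hxy Ey ne']]] lt] := h4 _ _ r_hook0 Hc.
  have cr : (s r).1.1 = cid r by rewrite sN.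
  have cx : (s x).1.1 = cid r by rewrite sN // (h1 _ _ Ex).
  have fy : foreign adj (fun v => (s v).1.1) r (s y).1.1 -> cid r < (s y).1.1.
    by move/(k4 _ _ r_hook1); rewrite cr.
  have fy' : (s y).1.1 <> cid r -> cid r < (s y).1.1.
    by move=> nes; apply: fy; exists x, y; rewrite cx cr.
  case Hy: (hook0 y); last first.
    by have := fy'; rewrite sN //= Ey => /(_ ne'); lia.
  have [fMy minMy] := h2 _ Hy.
  have [_ /(_ isT) cy] := sH _ Hy.
  have le : M0 y <= cid r.
    by apply: minMy; exists y, x; rewrite adj_sym Ex Ey; split=> //; apply: nesym.
  have EMy : M0 y = cid r.
    by apply/eqP; apply/negPn/negP => /eqP ne2; have := fy'; rewrite cy => /(_ ne2); lia.
  have [q Eq cq] := root_ex wf0 y.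
  have Hq : hook0 q by rewrite (h1 _ _ cq).
  have [fMq minMq] := h2 _ Hq.
  have fE c0 : foreign adj cid q c0 <-> foreign adj cid y c0 by rewrite /foreign cq.
  exists q; rewrite !inE Eq eqxx andbT; apply/andP; split.
    by have [p _] := sH _ Hq; rewrite -lt0n.
  by rewrite -EMy eqn_leq minMq ?minMy //; apply/fE.
(* The default [r] is never taken on [R2], and [M0 (f r) = cid r] gives injectivity. *)
pose f r := odflt r [pick x | (x \in R0 :\: R1) && (M0 x == cid r)].
have fP r : r \in R2 -> f r \in R0 :\: R1 /\ M0 (f r) = cid r.
  move=> /key [x Hx]; rewrite /f; case: pickP => [y /andP [Hy /eqP E] //|/(_ x)].
  by rewrite Hx.
have f_inj : {in R2 &, injective f}.
  move=> u v u2 v2 E; have [_ Eu] := fP _ u2; have [_ Ev] := fP _ v2.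
  have Ec : cid u = cid v by rewrite -Eu -Ev E.
  have [_ /R1P [_]] := R2P _ u2; have [_ /R1P [_]] := R2P _ v2.
  by rewrite !inE => /eqP dv /eqP du; case: wf0 => _; apply.
have le1 : #|R2| <= #|R0 :\: R1|.
  rewrite -(card_in_imset f_inj); apply/subset_leq_card/subsetP => x /imsetP [r Hr ->].
  by case: (fP _ Hr).
have le2 : #|R2| <= #|R0 :&: R1|.
  apply/subset_leq_card/subsetP => x /R2P [_ x1]; rewrite inE x1 andbT.
  by case: (R1P _ x1).
by have := cardsID R1 R0; lia.
Qed.

End Halving.

(** Clusters start as singletons labelled by their identifiers. Since [n < 2 ^ (lg n).+1], that many
    halvings leave one tree; the final re-rooting selects the vertex holding a message. *)
Definition broadcast (n N idv : nat) (msg : option nat) : proc pkt (option nat) :=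
  bind (loopu 0 (lg n).+1
          (fun _ st => bind (hook_round n N idv true st) (hook_round n N idv false)) (idv, 0, 0))
    (fun st => bind (reroot n N idv st.1.2 st.2 true (isSome msg) msg)
       (fun z => Done _ (if z is Some p then p.2 else None))).

Definition broadcast_time (n N : nat) : nat :=
  (lg n).+1 * (hook_round_time n N + hook_round_time n N) + (n * N.+1 + n * N.+1).

Lemma runs_broadcast n N (adj : rel 'I_n) (id : 'I_n -> nat) (s : 'I_n) m :
  valid_network N adj id ->
  runs adj (broadcast_time n N)
    (fun v => broadcast n N (id v) (if v == s then Some m else None)) (fun=> Some m)
    (fun=> (lg n).+1 * ((12 * (lg N).+2 + 14) + (12 * (lg N).+2 + 14)) + 4).
Proof.
case=> adj_sym adj_irr adj_con id_inj id_rng.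
have id_le v : id v <= N by case/andP: (id_rng v).
pose I i (st : 'I_n -> nat * nat * nat) :=
  [/\ wf_clusters adj id (fun v => (st v).1.1) (fun v => (st v).1.2) (fun v => (st v).2),
      forall v, (st v).1.1 <= N
    & #|roots (fun v => (st v).1.2)| <= 1 \/ #|roots (fun v => (st v).1.2)| * 2 ^ i <= n].
have [||st Rst [wf cle Hroots]] := @runs_loopu _ _ adj _ (hook_round_time n N + hook_round_time n N)
  (fun v _ st => bind (hook_round n N (id v) true st) (hook_round n N (id v) false)) I
  (fun _ _ => (12 * (lg N).+2 + 14) + (12 * (lg N).+2 + 14)) (lg n).+1 (fun v => (id v, 0, 0)).
- move=> i st _ [wf cle Hr].
  have [st' [R' wf' cle' Hr']] := runs_phase adj_sym adj_con id_inj id_le wf cle.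
  exists st'.
    by apply: runs_weaken R' => // v; case: (st v) => [[]].
  split=> //; case: Hr' => [|Hr']; first by left.
  case: Hr => Hr; [left; lia | right].
  by apply: leq_trans Hr; rewrite expnS mulnA leq_mul2r mulnC Hr' orbT.
- split=> //=; first by split=> // u v _ _ /id_inj.
  by right; rewrite expn0 muln1 -[leqRHS]card_ord max_card.
have same u v : (st u).1.1 = (st v).1.1.
  have H1 : #|roots (fun v => (st v).1.2)| <= 1.
    case: Hroots => // H; have : n < 2 ^ (lg n).+1 by apply: trunc_log_ltn.
    by case: #|_| H => [|[|k]] //; lia.
  have [r Er <-] := root_ex wf u; have [q Eq <-] := root_ex wf v.
  suff -> : r = q by [].
  by apply: (card_le1_eqP H1); rewrite inE ?Er ?Eq.
pose msg v := if v == s then Some m else None.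
have sel_s v : isSome (msg v) -> v = s by rewrite /msg; case: eqP.
have [||||z Rz [_ z2 z3 z4]] := @runs_reroot n N adj id adj_sym id_inj id_le _ _ _ wf (fun=> true)
  (fun v => isSome (msg v)) msg.
- by [].
- by [].
- by move=> v _; exists s; rewrite /msg ?eqxx.
- by move=> u v _ /sel_s -> /sel_s ->.
(* Following the new parents lowers the depth while keeping the message field, until depth 0, where
   only the source sits. *)
have zE d v p q : z v = Some (d, p, q) -> q = Some m.
  elim: d v p q => [|d IH] v p q Ez.
    case: (z4 _ _ _ _ Ez) => [[sv _]|[u [d' [p' [_ _ _ _]]]]] //.
    by move: Ez; rewrite (z3 _ sv) (sel_s _ sv) /msg eqxx => [[_ <-]].
  case: (z4 _ _ _ _ Ez) => [[_]|[u [d' [p' [_ _ _ Eu [Ed]]]]]] //.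
  by apply: (IH u p' q); rewrite Eu Ed.
rewrite /broadcast_time.
apply: (@runs_le _ _ adj _ _ _ _ (fun v => \sum_(i < (lg n).+1) ((12 * (lg N).+2 + 14) + (12 * (lg N).+2 + 14)) + 4)).
  by move=> v; rewrite sum_nat_const card_ord.
apply: (runs_bind Rst).
apply: runs_out (runs_map (fun v z => if z is Some p then p.2 else None) Rz) => v /=.
by have := z2 v isT; case Ez: (z v) => [[[d p] q]|] // _; exact: zE Ez.
Qed.

(** With [2 ^ w <= 4 * N], each stage is a multiple of [X = n * N ^ 2 * lg N]: 12 and 96 for the two
    searches, 26 for each of the three cluster minima, 4 for re-rooting and 8 for merging, 198 in
    total. *)
Lemma hook_round_time_le n N : 0 < n -> 1 < N -> hook_round_time n N <= 200 * (n * N ^ 2 * lg N).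
Proof.
move=> n0 N1; rewrite /hook_round_time /cluster_min_time.
have L0 : 0 < lg N by rewrite trunc_log_gt0 N1.
have : 2 ^ lg N <= N by apply: trunc_logP; lia.
rewrite expnD -mulnn; move: (lg N) L0 => L L0 leN.
have : 2 ^ L.+2 <= 4 * N by rewrite !expnS; lia.
move: (2 ^ L.+2) => W leW {leN}.
have lw : L.+2 <= 3 * L by lia.
have N2 : N.+1 <= 2 * N by lia.
pose X := n * (N * N) * L.
have X2 : n * (N * N) <= X by apply: leq_pmulr.
have X1 : N * N <= X by apply: leq_trans X2; apply: leq_pmull.
have X3 : N * N * L <= X by rewrite /X -[n * _ * L]mulnA leq_pmull.
have X4 : L * N <= X by apply: leq_trans X3; rewrite mulnC -mulnA leq_pmull //; lia.
have Y1 : n * N <= n * (N * N) by rewrite leq_mul2l leq_pmulr ?orbT //; lia.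
have t1 : L.+2 * (1 * W) <= 12 * X.
  by rewrite mul1n; apply: leq_trans (leq_mul lw leW) _; rewrite mulnACA leq_mul2l.
have t2 : n * (L.+2 * (N.+1 * W)) <= 24 * X.
  apply: leq_trans (leq_mul (leqnn n) (leq_mul lw (leq_mul N2 leW))) _.
  by rewrite /X; lia.
have t3 : n * N.+1 <= 2 * X.
  apply: leq_trans (leq_mul (leqnn n) N2) _.
  by rewrite mulnCA leq_mul2l (leq_trans Y1 X2).
have t4 : (L.+2 + L.+2) * (1 * (W * W)) <= 96 * X.
  rewrite mul1n; apply: leq_trans (leq_mul (leq_add lw lw) (leq_mul leW leW)) _.
  by lia.
have t5 : N.+1 * (N.+1 + n * N.+1) <= 8 * X.
  apply: leq_trans (leq_mul N2 (leq_add N2 (leq_mul (leqnn n) N2))) _.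
  by lia.
rewrite -/X; lia.
Qed.

Theorem theorem10 :
  exists (A : algorithm) (c : nat),
    forall (n N : nat) (adj : rel 'I_n) (id : 'I_n -> nat) (s : 'I_n) (m : nat),
      2 <= n -> valid_network N adj id ->
      [/\ time A n N <= c * (n * N ^ 2 * lg N * lg n),
          (forall v, out A (config A adj N id s m (time A n N) v) = Some m)
        & (forall v, energy A adj N id s m (time A n N) v
                     <= c * (lg N ^ 3 * lg n))].
Proof.
(* Using [lg n + 1 <= 2 * lg n], the time needs a factor 804 (two rounds of 200 per phase, plus 4
   for the last re-rooting) and the energy a factor 204. *)
exists (proc_algorithm broadcast broadcast_time), 1000 => n N adj id s m n2 valid.
(* Distinct identifiers force [n <= N], so both logarithms are positive and absorb additive
   constants. *)
have N1 : 1 < N.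
  case: valid => _ _ _ id_inj id_rng; apply: leq_trans n2 _.
  rewrite -[n]size_enum_ord -(size_map id) -(size_iota 1 N).
  apply: uniq_leq_size; first by rewrite map_inj_uniq ?enum_uniq.
  by move=> k /mapP [v _ ->]; rewrite mem_iota add1n ltnS.
have LN : 0 < lg N by rewrite trunc_log_gt0 N1.
have Ln : 0 < lg n by rewrite trunc_log_gt0 n2.
have [H1 H2] := @runs_algorithm _ _ adj broadcast broadcast_time _ _ _ _ _
  (@runs_broadcast n N adj id s m valid) (fun=> erefl).
split=> [|v|v].
- rewrite /= /broadcast_time.
  have := hook_round_time_le (ltnW n2) N1; move: (hook_round_time n N) => T leT.
  move: (lg n) Ln (lg N) LN leT => l l0 L L0 leT.
  have : n * N.+1 <= 2 * (n * N ^ 2 * L).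
    apply: leq_trans (_ : n * (2 * N) <= _); first by rewrite leq_mul2l; lia.
    rewrite mulnCA leq_mul2l -mulnA leq_mul2l -mulnn -mulnA leq_pmulr ?orbT //.
    by rewrite muln_gt0 (ltnW N1).
  move: (n * N ^ 2 * L) leT => X leT leX; nia.
- by rewrite /config H1.
apply: leq_trans (H2 v) _.
(* The energy obtained is linear in [lg N]; this passes to the cube. *)
have : lg N <= lg N ^ 3 by rewrite -[leqLHS]expn1 leq_pexp2l.
move: (lg N ^ 3) => C leC; move: (lg N) LN leC (lg n) Ln => L L0 leC l l0; nia.
Qed.
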